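(* Let $a>0$, $b>0$. 1) The limiting variance of $\sqrt T(\tilde a_T-a)$ is smaller than the limiting variance of $\sqrt T(\hat a_T-a)$, that is, $$\frac{4a^2}{(\mathrm{Tr}\,Q)^2}\,\mathrm{Tr}\left(Q\tilde R_1Q_\infty^{(a,b)}\tilde R_1^*\right)<\frac{4a^2}{(\mathrm{Tr}\,Q)^2}\,\mathrm{Tr}\left(Q\tilde RQ_\infty^{(a,b)}\tilde R^*\right).$$ 2) The limiting variance of $\sqrt T(\tilde b_T-b)$ is smaller than the limiting variance of $\sqrt T(\hat b_T-b)$, that is, $$\frac{4b^2}{(\mathrm{Tr}\,Q)^2}\,\mathrm{Tr}\left(Q\tilde R_2Q_\infty^{(a,b)}\tilde R_2^*\right)<\frac{4b^2(b+1)^2}{(\mathrm{Tr}\,Q)^2}\,\mathrm{Tr}\left(Q\tilde RQ_\infty^{(a,b)}\tilde R^*\right).$$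
   Context: $D\subset\mathbb R^d$ is a bounded domain with smooth boundary. $\{e_n,n\in\mathbb N\}$ is an orthonormal basis of $L^2(D)$ and $A:\mathrm{Dom}(A)\subset L^2(D)\to L^2(D)$ is the diagonal operator with $Ae_n=-\alpha_n e_n$, where $\alpha_n>0$ for all $n$ and $\alpha_n\to\infty$; $\mathrm{Dom}(A)=\{x:\sum_n\alpha_n^2\langle x,e_n\rangle_{L^2(D)}^2<\infty\}$ and $\mathrm{Dom}((-A)^{1/2})=\{x:\sum_n\alpha_n\langle x,e_n\rangle_{L^2(D)}^2<\infty\}$, with norm $\|x\|_{\mathrm{Dom}((-A)^{1/2})}=\|(-A)^{1/2}x\|_{L^2(D)}$. $\Phi_1$ is a Hilbert–Schmidt operator on $L^2(D)$ such that $Q=\Phi_1\Phi_1^*$ is strictly positive (all eigenvalues $\lambda_n$ of $Q$ are $>0$, and $\mathrm{Tr}\,Q=\sum_n\lambda_n<\infty$). $V=\mathrm{Dom}((-A)^{1/2})\times L^2(D)$ is the Hilbert space with inner product $\langle (x_1,x_2)^\top,(y_1,y_2)^\top\rangle_V=\langle (-A)^{1/2}x_1,(-A)^{1/2}y_1\rangle_{L^2(D)}+\langle x_2,y_2\rangle_{L^2(D)}$. The operator $\mathcal A:\mathrm{Dom}(\mathcal A)=\mathrm{Dom}(A)\times\mathrm{Dom}((-A)^{1/2})\to V$ is $\mathcal A(x_1,x_2)^\top=(x_2,\ bAx_1-2ax_2)^\top$; it generates an exponentially stable strongly continuous semigroup $(S(t),t\ge0)$ on $V$. $\Phi:V\to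 V$ is $\Phi(x_1,x_2)^\top=(0,\Phi_1x_2)^\top$. $Q_\infty^{(a,b)}=\int_0^\infty S(t)\Phi\Phi^*S^*(t)\,dt$ (an operator on $V$). The operators $\tilde R,\tilde R_1,\tilde R_2:V\to L^2(D)$ are $\tilde R(x_1,x_2)^\top=\frac{2a}{b+1}x_1+x_2$, $\tilde R_1(x_1,x_2)^\top=x_2$, $\tilde R_2(x_1,x_2)^\top=2ax_1$, with adjoints $\tilde R^*,\tilde R_1^*,\tilde R_2^*:L^2(D)\to V$. For reference, with $X^{x_0}=(X_1^{x_0},X_2^{x_0})^\top$ the mild solution of $dX=\mathcal AX\,dt+\Phi\,dB$, $X(0)=x_0$ ($B=(0,\tilde B)^\top$, $\tilde B$ a standard cylindrical Brownian motion on $L^2(D)$; $x_0$ independent of $B$ with $\mathbb E\|x_0\|_V^2<\infty$), $Y_T=\frac1T\int_0^T\|X_1^{x_0}(t)\|^2_{\mathrm{Dom}((-A)^{1/2})}dt$, $H_T=\frac1T\int_0^T\|X_2^{x_0}(t)\|^2_{L^2(D)}dt$ and $I_T=Y_T+H_T$, the estimators are $\hat a_T=\frac{b+1}{4bI_T}\mathrm{Tr}\,Q$, $\hat b_T=\frac{\mathrm{Tr}\,Q}{4aI_T-\mathrm{Tr}\,Q}$, $\tilde a_T=\frac{\mathrm{Tr}\,Q}{4H_T}$, $\tilde b_T=\frac{H_T}{Y_T}$. The limiting variance of $\sqrt T(\cdot)$ means the variance of the centered Gaussian limit in law as $T\to\infty$; for the four estimators these limiting variances are the quantities displayed in the claim,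 and the claim consists of the two displayed inequalities. *)

(* Defs.v *)
From HB Require Import structures.
From mathcomp Require Import all_boot all_order all_algebra.
From mathcomp Require Import all_classical all_reals all_analysis.
From mathcomp Require Import ring lra.

Set Implicit Arguments.
Unset Strict Implicit.
Unset Printing Implicit Defensive.

Import Order.TTheory GRing.Theory Num.Theory.
Import numFieldNormedType.Exports.

Local Open Scope classical_set_scope.
Local Open Scope ring_scope.

Section euclidean_space.
Context {R : realType}.
Local Notation tupleR n := (n.-tuple (measurableTypeR R)).


Definition cons_tupleR n (x : measurableTypeR R * tupleR n) : tupleR n.+1 :=
  [the n.+1.-tuple _ of x.1 :: x.2].

Lemma measurable_cons_tupleR n : measurable_fun [set: _] (@cons_tupleR n).
Proof. exact: measurable_cons. Qed.

Section lebesgue_cons.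
Variables (n : nat) (m : {sigma_finite_measure set (tupleR n) -> \bar R}).

Definition lebesgue_cons : set (tupleR n.+1) -> \bar R :=
  pushforward (@lebesgue_measure R \x m)%E (@cons_tupleR n).

HB.instance Definition _ := Measure.copy lebesgue_cons
  (measure_function_pushforward__canonical__measure_function_Measure
     (@lebesgue_measure R \x m)%E (@measurable_cons_tupleR n)).

Lemma lebesgue_cons_sigma_finite : sigma_finite [set: _] lebesgue_cons.
Proof.
have /sigma_finiteP[F [TF ndF Foo]] := sigma_finiteT (@lebesgue_measure R).
have /sigma_finiteP[G [TG ndG Goo]] := sigma_finiteT m.
pose H k := (fun t => tnth t ord0) @^-1` F k `&`
            (fun t : tupleR n.+1 => [tuple of behead t] : tupleR n) @^-1` G k.
exists H => [|k].
  apply/seteqP; split => // t _.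
  have [i _ Fi] : (\bigcup_i F i) (tnth t ord0) by rewrite -TF.
  have [j _ Gj] : (\bigcup_i G i) [tuple of behead t] by rewrite -TG.
  exists (maxn i j) => //; split => /=.
    by apply: subsetPset Fi; apply: ndF; exact: leq_maxl.
  by apply: subsetPset Gj; apply: ndG; exact: leq_maxr.
have [mF Fk] := Foo k; have [mG Gk] := Goo k.
have mH : measurable (H k).
  apply: measurableI; rewrite -[X in measurable X]setTI.
    exact: measurable_tnth.
  exact: measurable_behead.
split => //; rewrite /lebesgue_cons /pushforward.
rewrite (_ : @cons_tupleR n @^-1` H k = F k `*` G k); last first.
  apply/seteqP; split=> [] [x t]; rewrite /H /cons_tupleR /=.
    by move=> [+ Gt]; rewrite tnth0 => Fx; split => //=; congr (G k _): Gt; exact/val_inj.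
  by move=> [Fx Gt]; split; rewrite ?tnth0//; congr (G k _): Gt; exact/val_inj.
by rewrite product_measure1E// lte_mul_pinfty// ge0_fin_numE.
Qed.

HB.instance Definition _ := @Measure_isSigmaFinite.Build _ _ _ lebesgue_cons lebesgue_cons_sigma_finite.
End lebesgue_cons.
Definition lebesgue_nil : set (tupleR 0) -> \bar R :=
  \d_[tuple].
HB.instance Definition _ := Measure.on lebesgue_nil.
Lemma lebesgue_nil_sigma_finite : sigma_finite [set: _] lebesgue_nil.
Proof.
apply: fin_num_fun_sigma_finite => //; first by rewrite measure0.
Qed.
HB.instance Definition _ := @Measure_isSigmaFinite.Build _ _ _ lebesgue_nil lebesgue_nil_sigma_finite.

Fixpoint lebesgue_tuple n : {sigma_finite_measure set (tupleR n) -> \bar R} :=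
  match n with
  | 0 => lebesgue_nil
  | n.+1 => lebesgue_cons (lebesgue_tuple n)
  end.

Definition borelRn n := g_sigma_algebraType (@open 'rV[R]_n).

Lemma measurable_row n : measurable_fun [set: n.-tuple (measurableTypeR R)]
  ((fun t => \row_i tnth t i) : _ -> borelRn n).
Proof.
apply: (@measurability _ _ _ (borelRn n) _ _ (@open 'rV[R]_n) erefl) => _ [U oU <-]; rewrite setTI.
pose B (c : 'rV[rat]_n * rat) :=
  [set t : n.-tuple (measurableTypeR R) |
     forall i, tnth t i \in `](ratr (c.1 0 i) - ratr c.2), (ratr (c.1 0 i) + ratr c.2)[%R].
pose I := [set c | B c `<=` (fun t => \row_i tnth t i) @^-1` U].
have -> : (fun t : n.-tuple (measurableTypeR R) => \row_i tnth t i) @^-1` U =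
   \bigcup_(c in I) B c.
  apply/seteqP; split => [t Ut|t [c Ic Bc]]; last exact: Ic.
  have /nbhs_ballP[e /= e0 eU] : nbhs (\row_i tnth t i : 'rV[R]_n) U.
    exact: open_nbhs_nbhs.
  have [r] := rat_in_itvoo (divr_gt0 e0 (ltr0n _ 2)); rewrite in_itv/= => /andP[r0 re].
  have q_ i : exists q : rat, ratr q \in `](tnth t i - ratr r), (tnth t i + ratr r)[%R.
    by apply: rat_in_itvoo; lra.
  pose q := \row_i sval (cid (q_ i)).
  have qP i : ratr (q 0 i) \in `](tnth t i - ratr r), (tnth t i + ratr r)[%R.
    by rewrite mxE; case: cid.
  exists (q, r); last first.
    by move=> i; move: (qP i); rewrite !in_itv/= => /andP[? ?]; apply/andP; split; lra.
  move=> s Bs /=; apply: eU; split=> // j i; rewrite !mxE.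
  move: (qP i) (Bs i); rewrite !in_itv/= => /andP[? ?] /andP[? ?].
  by rewrite /ball/= ltr_norml; apply/andP; split; lra.
rewrite bigcup_mkcond; apply: countable_bigcupT_measurable => [|c].
  exact: countableP.
case: ifP => // _; rewrite /B.
rewrite (_ : [set t | _] = \bigcap_(i in [set: 'I_n]) (fun t => tnth t i) @^-1`
    `](ratr (c.1 0 i) - ratr c.2), (ratr (c.1 0 i) + ratr c.2)[%classic); last first.
  by apply/seteqP; split => t /= h i; [move=> _; exact: h|exact: h].
apply: fin_bigcap_measurable => [|i _]; first exact: finite_finset.
rewrite -[X in measurable X]setTI; apply: measurable_tnth => //.
Qed.

(* Lebesgue measure on the Borel sets of R^n: the n-fold product measure
   [lebesgue_tuple n], transported from n-tuples to row vectors. *)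
Definition lebesgue_Rn n : set (borelRn n) -> \bar R :=
  pushforward (lebesgue_tuple n) ((fun t => \row_i tnth t i) : tupleR n -> borelRn n).

HB.instance Definition _ n := Measure.copy (@lebesgue_Rn n)
  (measure_function_pushforward__canonical__measure_function_Measure
     (lebesgue_tuple n) (@measurable_row n)).

Variable n : nat.

Fixpoint Ck (k : nat) (f : 'rV[R]_n -> R) : Prop :=
  if k is k'.+1 then
    (forall x v, derivable f x v) /\ forall v, Ck k' (fun x => 'D_v f x)
  else continuous f.

Definition smooth (f : 'rV[R]_n -> R) := forall k, Ck k f.

(* Near each boundary point p, D is the sublevel set {phi < 0} of a smooth
   function phi whose differential at p is nonzero. *)
Definition smooth_boundary (D : set 'rV[R]_n) :=
  forall p, (closure D `\` D^°) p ->
  exists (U : set 'rV[R]_n) (phi : 'rV[R]_n -> R),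
    [/\ open_nbhs p U, smooth phi, phi p = 0, exists v, 'D_v phi p != 0 &
        D `&` U = [set x | phi x < 0] `&` U].

Record smooth_domain := SmoothDomain {
  domain_set :> set 'rV[R]_n;
  domain_nonempty : domain_set !=set0;
  domain_open : open domain_set;
  domain_connected : connected domain_set;
  domain_bounded : bounded_set domain_set;
  domain_smooth : smooth_boundary domain_set }.

Lemma domain_measurable (D : smooth_domain) :
  measurable (domain_set D : set (borelRn n)).
Proof. by apply: sub_sigma_algebra; exact: domain_open. Qed.

Definition lebesgue_on (D : smooth_domain) :
    {measure set (borelRn n) -> \bar R} :=
  mrestr (@lebesgue_Rn n) (domain_measurable D).

End euclidean_space.
Arguments smooth_domain : clear implicits.

(* L^2(mu) is rebuilt as a quotient of [LfunType] because [LspaceType2] carries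
   neither a vector space structure nor an inner product. *)
Section L2.
Context d (T : measurableType d) (R : realType) (mu : {measure set T -> \bar R}).
Local Notation Lfun2 := (LfunType mu (lee1n 2)).

Definition null_Lfun : {pred Lfun2} := fun f => `[< (f : T -> R) = cst 0 %[ae mu] >].

Lemma null_LfunP (f : Lfun2) :
  reflect ((f : T -> R) = cst 0 %[ae mu]) (f \in null_Lfun).
Proof. exact: asboolP. Qed.

Lemma null_Lfun_zmod_closed : zmod_closed null_Lfun.
Proof.
split=> [|f g /null_LfunP f0 /null_LfunP g0]; apply/null_LfunP.
  exact: aeW.
by apply: filterS2 f0 g0 => x /(_ I) fx /(_ I) gx _; have -> : (f - g) x = f x - g x by []; rewrite fx gx subrr.
Qed.

HB.instance Definition _ := GRing.isZmodClosed.Build Lfun2 null_Lfun null_Lfun_zmod_closed.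

Definition L2 : Type := Quotient.quot null_Lfun.
HB.instance Definition _ := GRing.Zmodule.on L2.
HB.instance Definition _ := EqQuotient.on L2.
Local Open Scope quotient_scope.

Lemma L2_eqP (f g : Lfun2) :
  (\pi_L2 f = \pi_L2 g) <-> (f : T -> R) = g %[ae mu].
Proof.
have -> : (\pi_L2 f = \pi_L2 g) <-> f - g \in null_Lfun.
  by rewrite Quotient.idealrBE; split=> /eqP.
have fgE x : (f - g) x = f x - g x by [].
split=> [/null_LfunP|] h; [|apply/null_LfunP]; apply: filterS h => x /(_ I) h _.
  by apply/eqP; rewrite -subr_eq0 -fgE h.
by rewrite fgE h subrr.
Qed.

Lemma repr_piL2 (f : Lfun2) : (repr (\pi_L2 f) : T -> R) = f %[ae mu].
Proof. by apply/L2_eqP; rewrite reprK. Qed.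

Definition L2_scale (a : R) (f : L2) : L2 := \pi_L2 (a *: repr f).

Lemma L2_scale_pi a (f : Lfun2) : L2_scale a (\pi_L2 f) = \pi_L2 (a *: f).
Proof.
apply/L2_eqP; apply: filterS (repr_piL2 f) => x /(_ I) fx _.
have scaleE (g : Lfun2) : (a *: g) x = a * g x by [].
by rewrite !scaleE fx.
Qed.

Lemma L2_addE (f g : Lfun2) : \pi_L2 f + \pi_L2 g = \pi_L2 (f + g) :> L2.
Proof. by rewrite !piE. Qed.

Lemma L2_scalerA a b f : L2_scale a (L2_scale b f) = L2_scale (a * b) f.
Proof. by elim/quotW: f => f; rewrite (L2_scale_pi b f) !L2_scale_pi scalerA. Qed.

Lemma L2_scale1r : left_id 1 L2_scale.
Proof. by elim/quotW => f; rewrite L2_scale_pi scale1r. Qed.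

Lemma L2_scalerDr : right_distributive L2_scale +%R.
Proof.
move=> a; elim/quotW => f; elim/quotW => g.
by rewrite L2_addE !L2_scale_pi L2_addE scalerDr.
Qed.

Lemma L2_scalerDl f : {morph L2_scale^~ f : a b / a + b}.
Proof. by elim/quotW: f => f a b; rewrite !L2_scale_pi L2_addE scalerDl. Qed.

HB.instance Definition _ := GRing.Zmodule_isLmodule.Build R L2
  L2_scalerA L2_scale1r L2_scalerDr L2_scalerDl.

Lemma L2_scaleE a (f : Lfun2) : a *: (\pi_L2 f) = \pi_L2 (a *: f) :> L2.
Proof. exact: L2_scale_pi. Qed.

Definition L2_ip (f g : L2) : R := Rintegral mu [set: T] (repr f \* repr g).

Lemma L2_mul_integrable (f g : Lfun2) :
  mu.-integrable [set: T] (EFin \o (f \* g)).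
Proof. by apply/Lfun1_integrable; apply: Lfun2_mul_Lfun1; exact: LfunP. Qed.

Lemma L2_ipE (f g : Lfun2) :
  L2_ip (\pi_L2 f) (\pi_L2 g) = Rintegral mu [set: T] (f \* g).
Proof.
rewrite /L2_ip /Rintegral; congr fine; apply: ae_eq_integral => //.
- exact: measurable_int (L2_mul_integrable _ _).
- exact: measurable_int (L2_mul_integrable _ _).
- apply: filterS2 (repr_piL2 f) (repr_piL2 g) => x /(_ I) fx /(_ I) gx _ /=.
  by rewrite fx gx.
Qed.

Lemma L2_ipC f g : L2_ip f g = L2_ip g f.
Proof. by rewrite /L2_ip; congr Rintegral; apply/funext => x /=; rewrite mulrC. Qed.

Lemma L2_ip_linear f : linear_for *%R (L2_ip f).
Proof.
elim/quotW: f => f a; elim/quotW => g; elim/quotW => h; rewrite L2_scaleE L2_addE !L2_ipE.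
rewrite -RintegralZl//; last exact: L2_mul_integrable.
rewrite -RintegralD//; last 2 first.
- by apply: eq_integrable (L2_mul_integrable (a *: f) g) => // x _ /=; rewrite mulrA.
- exact: L2_mul_integrable.
have eqE (x : T) : (a *: g + h) x = a * g x + h x by [].
by apply: eq_Rintegral => x _; rewrite /= [X in _ * X]eqE mulrDr mulrCA.
Qed.

Lemma L2_ip_gt0 f : f != 0 -> 0 < L2_ip f f.
Proof.
move=> f0.
have ff_ge0 : 0 <= L2_ip f f.
  by apply: Rintegral_ge0 => x _; rewrite /= -expr2 sqr_ge0.
rewrite lt_neqAle ff_ge0 andbT.
apply: contra f0 => /eqP/esym ff0; apply/eqP; rewrite -[f]reprK.
have -> : 0 = \pi_L2 (0 : Lfun2) by rewrite !piE.
apply/L2_eqP.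
have iff := L2_mul_integrable (repr f) (repr f).
have mff := measurable_int _ iff.
have : (EFin \o (repr f \* repr f)) = cst 0%E %[ae mu].
  apply/(ae_eq_integral_abs mu measurableT mff).
  under eq_integral do rewrite /= ger0_norm -?expr2 ?sqr_ge0//.
  apply/eqP; rewrite -fine_eq0.
    exact/eqP.
  by have := integrable_fin_num measurableT iff.
apply: filterS => x /(_ I) /= [/eqP fx] _.
by move: fx; rewrite mulf_eq0 orbb => /eqP.
Qed.

Lemma L2_ip_bilinear : bilinear_for *%R (idfun \; *%R) L2_ip.
Proof.
split=> [g a f h|f]; last exact: L2_ip_linear.
by rewrite -![L2_ip _ g]L2_ipC; exact: L2_ip_linear.
Qed.

Lemma L2_ip_sym f g : L2_ip f g = (-1) ^+ false * L2_ip g f.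
Proof. by rewrite expr0 mul1r L2_ipC. Qed.

HB.instance Definition _ := bilinear_isBilinear.Build R L2 L2 R *%R (idfun \; *%R)
  L2_ip L2_ip_bilinear.
HB.instance Definition _ := isHermitianSesquilinear.Build R L2 false idfun
  L2_ip L2_ip_sym.
HB.instance Definition _ := isDotProduct.Build R L2 L2_ip L2_ip_gt0.
End L2.
Arguments L2 {d T R} mu.
Arguments L2_ip {d T R} mu f g.

(* Operators between real inner product spaces. The inner products are passed
   as explicit functions because the energy space below has its own. *)
Section inner_product.
Context {R : realType}.

Definition ip_norm (U : lmodType R) (ip : U -> U -> R) (x : U) : R :=
  Num.sqrt (ip x x).

Definition ip_cvg (U : lmodType R) (ip : U -> U -> R) (u : nat -> U) (l : U) :=
  ip_norm ip (u n - l) @[n --> \oo] --> (0 : R).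

Definition ip_lim (U : lmodType R) (ip : U -> U -> R) (u : nat -> U) : U :=
  xget 0 [set l | ip_cvg ip u l].

Definition orthonormal_basis (U : lmodType R) (ip : U -> U -> R)
    (e : nat -> U) :=
  (forall i j, ip (e i) (e j) = (i == j)%:R) /\
  (forall x, ip_cvg ip (fun n => \sum_(k < n) ip x (e k) *: e k) x).

Definition bounded_op (U W : lmodType R) (ipU : U -> U -> R)
    (ipW : W -> W -> R) (T : U -> W) :=
  exists M : R, forall x, ip_norm ipW (T x) <= M * ip_norm ipU x.

Definition adjoint (U W : lmodType R) (ipU : U -> U -> R)
    (ipW : W -> W -> R) (T : U -> W) (y : W) : U :=
  xget 0 [set z | forall x, ipW (T x) y = ipU x z].

Definition hilbert_schmidt (U : lmodType R) (ip : U -> U -> R)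
    (T : {linear U -> U}) :=
  bounded_op ip ip T /\
  exists2 f : nat -> U, orthonormal_basis ip f &
    cvgn (series (fun n => ip_norm ip (T (f n)) ^+ 2)).

Definition positive_eigenvalues (U : lmodType R) (T : U -> U) :=
  forall (lambda : R) (x : U), x != 0 -> T x = lambda *: x -> 0 < lambda.

(* The trace is the common value of the sums of <T f_n, f_n> over all
   orthonormal bases f. *)
Definition trace (U : lmodType R) (ip : U -> U -> R) (T : U -> U) : R :=
  xget 0 [set t | forall f : nat -> U, orthonormal_basis ip f ->
    series (fun n => ip (T (f n)) (f n)) @ \oo --> t].

(* The weak integral of G over [0, +oo[. *)
Definition op_integral (U : lmodType R) (ip : U -> U -> R)
    (G : R -> U -> U) (x : U) : U :=
  xget 0 [set z | forall y,
    lebesgue_measure.-integrable `[0, +oo[ (fun t => (ip (G t x) y)%:E) /\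
    ip z y = Rintegral lebesgue_measure `[0, +oo[ (fun t => ip (G t x) y)].

Section semigroup.
Variables (U : lmodType R) (ip : U -> U -> R) (S : R -> {linear U -> U}).

Definition C0_semigroup :=
  [/\ forall t, 0 <= t -> bounded_op ip ip (S t),
      forall x, S 0 x = x,
      forall s t x, 0 <= s -> 0 <= t -> S (s + t) x = S s (S t x) &
      forall x, ip_norm ip (S t x - x) @[t --> 0^'+] --> (0 : R)].

Definition exponentially_stable :=
  exists M omega : R, 0 < omega /\
    forall t x, 0 <= t ->
      ip_norm ip (S t x) <= M * expR (- omega * t) * ip_norm ip x.

(* The generator of S is exactly A with domain domA. *)
Definition generated_by (domA : set U) (A : U -> U) :=
  forall x y, (domA x /\ A x = y) <->
    (ip_norm ip (h^-1 *: (S h x - x) - y) @[h --> 0^'+] --> (0 : R)).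

End semigroup.
End inner_product.

(* The operator x |-> \sum_n c_n <x, e_n> e_n, for an orthonormal basis e. Below,
   c_n = - alpha_n gives A and c_n = sqrt alpha_n gives (-A)^{1/2}. *)
Section diagonal_operator.
Context (R : realType) (H : lmodType R) (ip : {dot H for idfun}).
Variables (e : nat -> H) (c : nat -> R).

Definition diag_dom : set H :=
  [set x | cvgn (series (fun n => c n ^+ 2 * ip x (e n) ^+ 2))].

Definition diag_op (x : H) : H :=
  ip_lim ip (fun n => \sum_(k < n) (c k * ip x (e k)) *: e k).

Definition diag_pred : {pred H} := fun x => `[< diag_dom x >].

Lemma diag_submod_closed : submod_closed diag_pred.
Proof.
split=> [|k x y /asboolP Dx /asboolP Dy]; apply/asboolP.
  rewrite /diag_dom/=; under eq_fun do rewrite linear0l expr0n mulr0.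
  rewrite (_ : series _ = fun=> 0); first exact: is_cvg_cst.
  by apply/funext => n; rewrite /series/= big1.
pose v := k ^+ 2 *: (2 *: (fun n => c n ^+ 2 * ip x (e n) ^+ 2)) +
          2 *: (fun n => c n ^+ 2 * ip y (e n) ^+ 2).
have vE n : v n = k ^+ 2 * (2 * (c n ^+ 2 * ip x (e n) ^+ 2)) +
                  2 * (c n ^+ 2 * ip y (e n) ^+ 2) by [].
rewrite /diag_dom /=; apply: (@series_le_cvg _ _ v) => [n|n|n|].
- by rewrite mulr_ge0 ?sqr_ge0.
- have [p_ge0 q_ge0] : 0 <= c n ^+ 2 * ip x (e n) ^+ 2 /\
                        0 <= c n ^+ 2 * ip y (e n) ^+ 2.
    by split; rewrite mulr_ge0 ?sqr_ge0.
  by rewrite vE addr_ge0// mulr_ge0 ?sqr_ge0// mulr_ge0.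
- rewrite linearPl vE /=; set p := ip x _; set q := ip y _.
  rewrite -subr_ge0 (_ : _ - _ = (c n * (k * p - q)) ^+ 2) ?sqr_ge0//; ring.
- apply: is_cvg_seriesD; last exact: is_cvg_seriesZ Dy.
  exact: is_cvg_seriesZ (is_cvg_seriesZ Dx).
Qed.

HB.instance Definition _ :=
  GRing.isSubmodClosed.Build R H diag_pred diag_submod_closed.

Record diag_space := DiagSpace { diag_val :> H; _ : diag_val \in diag_pred }.

HB.instance Definition _ := [isSub for diag_val].
HB.instance Definition _ := [Choice of diag_space by <:].
HB.instance Definition _ := [SubChoice_isSubLmodule of diag_space by <:].

End diagonal_operator.

Section damped_wave.
Context (R : realType) (H : lmodType R) (ip : {dot H for idfun}).
Variables (e : nat -> H) (alpha : nat -> R).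

Let sqrt_alpha n := Num.sqrt (alpha n).

Definition half_space : lmodType R := diag_space ip e sqrt_alpha.

Definition energy_space : lmodType R := (half_space * H)%type.

Definition energy_ip (x y : energy_space) : R :=
  ip (diag_op ip e sqrt_alpha (diag_val x.1))
     (diag_op ip e sqrt_alpha (diag_val y.1)) + ip x.2 y.2.

Variables (a b : R).

Definition wave_dom : set energy_space :=
  [set x | diag_dom ip e (fun n => - alpha n) (diag_val x.1) /\
           diag_dom ip e sqrt_alpha x.2].

(* Meaningful on [wave_dom]; there [insubd] only records that x.2 belongs to
   Dom((-A)^{1/2}). *)
Definition wave_op (x : energy_space) : energy_space :=
  (insubd (0 : half_space) x.2,
   b *: diag_op ip e (fun n => - alpha n) (diag_val x.1) - (2 * a) *: x.2).

Variable Phi1 : H -> H.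

Definition noise_cov : H -> H := Phi1 \o adjoint ip ip Phi1.

Definition noise_op (x : energy_space) : energy_space := (0, Phi1 x.2).

Definition Q_infty (S : R -> energy_space -> energy_space) :
    energy_space -> energy_space :=
  op_integral energy_ip (fun t =>
    S t \o noise_op \o adjoint energy_ip energy_ip noise_op
    \o adjoint energy_ip energy_ip (S t)).

Definition R_tilde (x : energy_space) : H :=
  (2 * a / (b + 1)) *: diag_val x.1 + x.2.

Definition R_tilde1 (x : energy_space) : H := x.2.

Definition R_tilde2 (x : energy_space) : H := (2 * a) *: diag_val x.1.

Definition cov_trace (S : R -> energy_space -> energy_space)
    (K : energy_space -> H) : R :=
  trace ip (noise_cov \o K \o Q_infty S \o adjoint energy_ip ip K).

End damped_wave.
Arguments half_space {R H} ip e alpha.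
Arguments energy_space {R H} ip e alpha.
Arguments energy_ip {R H} ip e alpha x y.
Arguments wave_dom {R H} ip e alpha _.
Arguments wave_op {R H} ip e alpha a b x.
Arguments R_tilde {R H} ip e alpha a b x.
Arguments R_tilde1 {R H} ip e alpha x.
Arguments R_tilde2 {R H} ip e alpha a x.
Arguments Q_infty {R H} ip e alpha Phi1 S _.
Arguments cov_trace {R H} ip e alpha Phi1 S K.

(* Main.v *)
Require Import Defs.
From HB Require Import structures.
From mathcomp Require Import all_boot all_order all_algebra.
From mathcomp Require Import all_classical all_reals all_analysis.
From mathcomp Require Import measurable_realfun.
From mathcomp Require Import ring lra.

Set Implicit Arguments.
Unset Strict Implicit.
Unset Printing Implicit Defensive.

Import Order.TTheory GRing.Theory Num.Theory.
Import numFieldNormedType.Exports.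

Local Open Scope classical_set_scope.
Local Open Scope ring_scope.

(** The stationary covariance is the Gramian
    [<Q_infty x, y> = \int_0^oo <Phi* S*(t) x, Phi* S*(t) y> dt], and
    [Tr (Q R Q_infty R* )] equals [\sum_m <Q_infty R* Phi1 f_m, R* Phi1 f_m>] for
    the basis [f] in which [Phi1] is Hilbert-Schmidt.  Put [p u = ((-A)^{-1} u, 0)]
    and [r u = (0, u)].  Then [R1* = r], [R2* = 2a p] and [R* = c p + r] with
    [c = 2a / (b + 1)].  Since [d/dt <S(t) z, p u> = <S(t) z, r u>], the integrand of
    [<Q_infty (p u), r u>] is a total derivative that integrates to zero: position
    and velocity are uncorrelated in the stationary regime.  Hence, writing [T1] and
    [T2] for the sums built from [p] and [r], the traces for [R1], [R2], [R] are
    [T2], [4 a^2 T1] and [c^2 T1 + T2], and both inequalities reduce to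
    [T1 > 0] and [T2 > 0]. *)

(** [adjoint], [trace], [op_integral] and [ip_lim] are choices made by [xget], so each needs an
    existence argument before anything can be computed with it. This is why completeness of L^2 and
    the Riesz property of both spaces lie underneath everything else.

    The total-derivative argument meets two obstacles. The vector [(0, u)] is in the domain of the
    generator only when [u] is in Dom((-A)^{1/2}), which [Phi1 f_m] need not be; and the adjoint
    semigroup is only accessible through scalar products. Projecting onto the first [N] vectors of
    [e] removes both, and the limit in [N] is taken under the integral.

    The trace is a third obstacle. It must have the same value along all bases, but the operator
    inside it is a product that need not be symmetric, so its diagonal sums are not sums of squares.
    Hence the detour through Hilbert-Schmidt norms.

    The weight [c] satisfies [(b + 1)^2 c^2 = 4 a^2]: in the second inequality the position terms
    cancel exactly and the gap is [(b + 1)^2 T2], while in the first it is [c^2 T1], up to the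
    common prefactors. *)

Lemma cvgn_unique {R : realType} (u : nat -> R) (l l' : R) :
  u @ \oo --> l -> u @ \oo --> l' -> l = l'.
Proof. by move=> /cvg_lim <- // /cvg_lim <-. Qed.

Lemma nneg_series_nd {R : realType} (c : nat -> R) :
  (forall k, 0 <= c k) -> nondecreasing_seq (series c).
Proof.
by move=> c0; apply/nondecreasing_seqP => n; rewrite -subr_ge0 seriesSB.
Qed.

Lemma nneg_series_le {R : realType} (c : nat -> R) l n : (forall k, 0 <= c k) ->
  series c @ \oo --> l -> \sum_(k < n) c k <= l.
Proof.
move=> c0 cl; have := nondecreasing_cvgn_le (nneg_series_nd c0) (cvgP _ cl) n.
by rewrite (cvg_lim _ cl)// /series/= big_mkord.
Qed.

Lemma nneg_series_cvg {R : realType} (c : nat -> R) M : (forall k, 0 <= c k) ->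
  (forall n, \sum_(k < n) c k <= M) -> cvgn (series c).
Proof.
move=> c0 cM; apply: nondecreasing_is_cvgn; first exact: nneg_series_nd.
by exists M => _ [n _ <-]; rewrite /series/= big_mkord.
Qed.

(** * Inner product spaces: Cauchy-Schwarz, orthonormal bases, Riesz representation *)

Section inner_product_space.
Context {R : realType}.

Definition inner_product (U : lmodType R) (ip : U -> U -> R) :=
  [/\ forall x y, ip x y = ip y x,
      forall a x y z, ip (a *: x + y) z = a * ip x z + ip y z &
      forall x, x != 0 -> 0 < ip x x].

Definition ip_complete (U : lmodType R) (ip : U -> U -> R) :=
  forall u : nat -> U,
    (forall eps, 0 < eps -> exists N, forall m n, (N <= m)%N -> (N <= n)%N ->
       ip_norm ip (u m - u n) < eps) ->
    exists l, ip_cvg ip u l.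

(** This is the form in which completeness is used for adjoints. Isolating it lets the energy space
    inherit it from [H] without a separate proof that the energy space is complete. *)
Definition riesz (U : lmodType R) (ip : U -> U -> R) :=
  forall F : U -> R, (forall a x y, F (a *: x + y) = a * F x + F y) ->
    (exists M, forall x, `|F x| <= M * ip_norm ip x) ->
    exists z, forall x, F x = ip x z.

Lemma dot_inner_product (U : lmodType R) (ip : {dot U for idfun}) :
  inner_product ip.
Proof.
split=> [x y|a x y z|x].
- by have := @hermitian_subproof _ _ _ _ ip x y; rewrite expr0 mul1r.
- by rewrite linearPl.
- exact: neq0_dnorm_gt0.
Qed.

Section theory.
Variables (U : lmodType R) (ip : U -> U -> R).
Hypothesis ipP : inner_product ip.
Local Notation "''|' x |" := (ip_norm ip x) (at level 0, x at level 99).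

Lemma ipC x y : ip x y = ip y x. Proof. by case: ipP. Qed.
Lemma ip0l x : ip 0 x = 0.
Proof.
by case: ipP => _ h _; have := h 1 0 0 x; rewrite scaler0 addr0 mul1r; lra.
Qed.
Lemma ipDl x y z : ip (x + y) z = ip x z + ip y z.
Proof. by case: ipP => _ h _; have := h 1 x y z; rewrite scale1r mul1r. Qed.
Lemma ipZl a x z : ip (a *: x) z = a * ip x z.
Proof. by case: ipP => _ h _; have := h a x 0 z; rewrite addr0 ip0l addr0. Qed.
Lemma ipNl x z : ip (- x) z = - ip x z.
Proof. by rewrite -scaleN1r ipZl mulN1r. Qed.
Lemma ipBl x y z : ip (x - y) z = ip x z - ip y z.
Proof. by rewrite ipDl ipNl. Qed.
Lemma ip0r x : ip x 0 = 0. Proof. by rewrite ipC ip0l. Qed.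
Lemma ipDr x y z : ip z (x + y) = ip z x + ip z y.
Proof. by rewrite ipC ipDl !(ipC z). Qed.
Lemma ipZr a x z : ip z (a *: x) = a * ip z x.
Proof. by rewrite ipC ipZl (ipC z). Qed.
Lemma ipNr x z : ip z (- x) = - ip z x.
Proof. by rewrite ipC ipNl (ipC z). Qed.
Lemma ipBr x y z : ip z (x - y) = ip z x - ip z y.
Proof. by rewrite ipDr ipNr. Qed.
Lemma ip_suml n (F : 'I_n -> U) z :
  ip (\sum_(k < n) F k) z = \sum_(k < n) ip (F k) z.
Proof. by rewrite (big_morph (ip ^~ z) (fun x y => ipDl x y z) (ip0l z)). Qed.
Lemma ip_sumr n (F : 'I_n -> U) z :
  ip z (\sum_(k < n) F k) = \sum_(k < n) ip z (F k).
Proof. by rewrite ipC ip_suml; apply: eq_bigr => k _; rewrite ipC. Qed.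

Lemma ip_gt0 x : x != 0 -> 0 < ip x x. Proof. by case: ipP => _ _; exact. Qed.
Lemma ip_ge0 x : 0 <= ip x x.
Proof. by have [->|/ip_gt0/ltW//] := eqVneq x 0; rewrite ip0l. Qed.
Lemma ip_eq0 x : ip x x = 0 -> x = 0.
Proof. by have [//|/ip_gt0] := eqVneq x 0; move=> /[swap] ->; rewrite ltxx. Qed.
Lemma ip_inj x y : (forall z, ip z x = ip z y) -> x = y.
Proof.
by move=> h; apply/subr0_eq/ip_eq0; rewrite ipBr h subrr.
Qed.

Lemma ip_norm_ge0 x : 0 <= '|x|. Proof. exact: sqrtr_ge0. Qed.
Lemma ip_norm_sqr x : '|x| ^+ 2 = ip x x.
Proof. by rewrite sqr_sqrtr// ip_ge0. Qed.
Lemma ip_norm0 : '|0| = 0. Proof. by rewrite /ip_norm ip0l sqrtr0. Qed.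
Lemma ip_normZ a x : '|a *: x| = `|a| * '|x|.
Proof.
by rewrite /ip_norm ipZl ipZr mulrA -expr2 sqrtrM ?sqr_ge0// sqrtr_sqr.
Qed.
Lemma ip_normN x : '|- x| = '|x|.
Proof. by rewrite -scaleN1r ip_normZ normrN1 mul1r. Qed.
Lemma ip_normB x y : '|x - y| = '|y - x|.
Proof. by rewrite -ip_normN opprB. Qed.

Lemma cauchy_schwarz x y : `|ip x y| <= '|x| * '|y|.
Proof.
have [->|y0] := eqVneq y 0; first by rewrite ip0r normr0 ip_norm0 mulr0.
have yy := ip_gt0 y0.
rewrite -(@ler_pXn2r _ 2)// ?nnegrE ?mulr_ge0 ?ip_norm_ge0//.
rewrite exprMn !ip_norm_sqr real_normK ?num_real//.
have := ip_ge0 (ip y y *: x - ip x y *: y).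
rewrite !(ipBl, ipBr, ipZl, ipZr) (ipC y x) => h.
rewrite -(ler_pM2l yy) -subr_ge0.
by apply: le_trans h _; rewrite le_eqVlt; apply/orP; left; apply/eqP; ring.
Qed.

Lemma ip_le_norm x y : ip x y <= '|x| * '|y|.
Proof. exact: le_trans (ler_norm _) (cauchy_schwarz _ _). Qed.

Lemma ip_normD x y : '|x + y| <= '|x| + '|y|.
Proof.
rewrite -(@ler_pXn2r _ 2)// ?nnegrE ?addr_ge0 ?ip_norm_ge0//.
rewrite sqrrD !ip_norm_sqr ipDl !ipDr (ipC y x).
have := ip_le_norm x y; lra.
Qed.

Lemma ip_norm_le_sub x y : `| '|x| - '|y| | <= '|x - y|.
Proof.
have h1 := ip_normD (x - y) y; have h2 := ip_normD (y - x) x.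
by rewrite !subrK (ip_normB y x) in h1 h2; rewrite ler_norml; lra.
Qed.

Lemma ip_cvgP (u : nat -> U) l : ip_cvg ip u l ->
  forall y, ip (u n) y @[n --> \oo] --> ip l y.
Proof.
move=> ul y; apply/cvgrPdistC_le => e e0.
have d0 : 0 < e / ('|y| + 1) by rewrite divr_gt0// ltr_wpDl ?ip_norm_ge0.
have := ul; move/cvgrPdist_le => /(_ _ d0); apply: filterS => n /=.
rewrite sub0r normrN ger0_norm ?ip_norm_ge0// => h.
rewrite -ipBl (le_trans (cauchy_schwarz _ _))//.
rewrite (le_trans (ler_wpM2r (ip_norm_ge0 _) h))//.
rewrite -mulrA ler_piMr ?(ltW e0)// mulrC ler_pdivrMr ?mul1r ?lerDl ?ler01//.
by rewrite ltr_wpDl ?ip_norm_ge0.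
Qed.

Lemma ip_cvg_norm (u : nat -> U) l : ip_cvg ip u l ->
  '|u n| @[n --> \oo] --> '|l|.
Proof.
move=> ul; apply/cvgrPdistC_le => e e0.
have := ul; move/cvgrPdist_le => /(_ _ e0); apply: filterS => n /=.
rewrite sub0r normrN ger0_norm ?ip_norm_ge0// => h.
exact: le_trans (ip_norm_le_sub _ _) h.
Qed.

Lemma ip_cvg_unique (u : nat -> U) l l' :
  ip_cvg ip u l -> ip_cvg ip u l' -> l = l'.
Proof.
move=> h h'; apply: ip_inj => z; rewrite !(ipC z).
exact: cvgn_unique (@ip_cvgP _ _ h z) (@ip_cvgP _ _ h' z).
Qed.

Lemma ip_limP (u : nat -> U) l : ip_cvg ip u l -> ip_lim ip u = l.
Proof.
move=> h; apply: xget_unique => // l' h'; exact: ip_cvg_unique h' h.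
Qed.

Section basis.
Variable f : nat -> U.
Hypothesis onb : orthonormal_basis ip f.

Lemma onb_ip i j : ip (f i) (f j) = (i == j)%:R. Proof. by case: onb. Qed.

Lemma parseval x y :
  series (fun n => ip x (f n) * ip y (f n)) @ \oo --> ip x y.
Proof.
case: onb => _ /(_ x)/ip_cvgP/(_ y); apply: cvg_trans; apply: near_eq_cvg.
near=> n; rewrite ip_suml /series /= big_mkord.
by apply: eq_bigr => k _; rewrite ipZl (ipC y).
Unshelve. all: by end_near. Qed.

Lemma parseval_sqr x : series (fun n => ip x (f n) ^+ 2) @ \oo --> '|x| ^+ 2.
Proof. by rewrite ip_norm_sqr; under eq_fun do rewrite expr2; exact: parseval. Qed.

Lemma bessel x n : \sum_(k < n) ip x (f k) ^+ 2 <= '|x| ^+ 2.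
Proof.
exact: nneg_series_le (fun k => sqr_ge0 (ip x (f k))) (@parseval_sqr x).
Qed.

Definition onb_proj n x := \sum_(k < n) ip x (f k) *: f k.

Lemma onb_proj_linear n a x y :
  onb_proj n (a *: x + y) = a *: onb_proj n x + onb_proj n y.
Proof.
rewrite /onb_proj scaler_sumr -big_split/=; apply: eq_bigr => k _.
by rewrite ipDl ipZl scalerDl scalerA.
Qed.

Lemma onb_proj_ip n x y : ip (onb_proj n x) y = \sum_(k < n) ip x (f k) * ip y (f k).
Proof.
rewrite /onb_proj ip_suml; apply: eq_bigr => k _.
by rewrite ipZl (ipC y).
Qed.

Lemma onb_proj_sym n x y : ip (onb_proj n x) y = ip x (onb_proj n y).
Proof.
by rewrite (ipC x) !onb_proj_ip; apply: eq_bigr => k _; rewrite mulrC.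
Qed.

Lemma sum_onb_sqr n (c : 'I_n -> R) :
  '|\sum_(k < n) c k *: f k| ^+ 2 = \sum_(k < n) c k ^+ 2.
Proof.
rewrite ip_norm_sqr ip_suml; apply: eq_bigr => i _.
rewrite ip_sumr (bigD1 i)//= !ipZl ipZr onb_ip eqxx big1 ?addr0 ?mulr1 ?expr2//.
by move=> j ji; rewrite ipZl ipZr onb_ip eq_sym -[(j == i :> nat)]/(j == i) (negbTE ji) !mulr0.
Qed.

Lemma onb_proj_idem n x : onb_proj n (onb_proj n x) = onb_proj n x.
Proof.
apply: ip_inj => z; rewrite !(ipC z) !onb_proj_ip; apply: eq_bigr => i _; congr (_ * _).
rewrite onb_proj_ip (bigD1 i)//= onb_ip eqxx mulr1 big1 ?addr0// => j ji.
by rewrite onb_ip eq_sym -[(j == i :> nat)]/(j == i) (negbTE ji) mulr0.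
Qed.

Lemma onb_proj_norm n x : '|onb_proj n x| <= '|x|.
Proof.
rewrite -(@ler_pXn2r _ 2)// ?nnegrE ?ip_norm_ge0//.
by rewrite sum_onb_sqr bessel.
Qed.

Lemma onb_proj_cvg x : ip_cvg ip (onb_proj ^~ x) x.
Proof. by case: onb => _ /(_ x). Qed.

Lemma onb_eq x y : (forall k, ip x (f k) = ip y (f k)) -> x = y.
Proof.
move=> h; apply: ip_cvg_unique (onb_proj_cvg x) _.
rewrite (_ : onb_proj ^~ x = onb_proj ^~ y); first exact: onb_proj_cvg.
by apply/funext => n; apply: eq_bigr => k _; rewrite h.
Qed.

Lemma onb_neq0 k : f k != 0.
Proof.
by apply/eqP => fk; have := onb_ip k k; rewrite fk ip0l eqxx => /esym/eqP; rewrite oner_eq0.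
Qed.

Hypothesis cU : ip_complete ip.

Lemma onb_series_ex (c : nat -> R) : cvgn (series (fun n => c n ^+ 2)) ->
  exists l, ip_cvg ip (fun n => \sum_(k < n) c k *: f k) l.
Proof.
move=> cc; apply: cU => eps e0.
have [N _ hN] : \forall n \near \oo,
    `|limn (series (fun n => c n ^+ 2)) - series (fun n => c n ^+ 2) n| < eps ^+ 2.
  by have /cvgrPdist_lt/(_ _ (exprn_gt0 2 e0)) := cc.
exists N.
suff H m n : (N <= m)%N -> (m <= n)%N ->
    '|\sum_(k < n) c k *: f k - \sum_(k < m) c k *: f k| < eps.
  move=> m n Nm Nn; have [mn|nm] := leqP m n; first by rewrite ip_normB H.
  by rewrite H// ltnW.
move=> Nm mn.
(* Zeroing the first [m] coefficients turns the difference of two partial sums into one orthogonal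
   sum over ['I_n], to which [sum_onb_sqr] applies. *)
pose c' k := if (k < m)%N then 0 else c k.
have -> : \sum_(k < n) c k *: f k - \sum_(k < m) c k *: f k =
    \sum_(k < n) c' k *: f k.
  rewrite [X in _ - X](big_ord_widen n (fun k => c k *: f k))//.
  rewrite [X in _ - X]big_mkcond -sumrB.
  by apply: eq_bigr => k _; rewrite /c'; case: ifP => _; rewrite ?subrr ?scale0r// subr0.
rewrite -(@ltr_pXn2r _ 2)// ?nnegrE ?ip_norm_ge0 ?(ltW e0)// sum_onb_sqr.
have -> : \sum_(k < n) c' k ^+ 2 = \sum_(k < n) c k ^+ 2 - \sum_(k < m) c k ^+ 2.
  rewrite [X in _ - X](big_ord_widen n (fun k => c k ^+ 2))//.
  rewrite [X in _ - X]big_mkcond -sumrB.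
  apply: eq_bigr => k _; rewrite /c'; case: ifP => _; rewrite ?subrr ?subr0//.
  by rewrite expr0n.
have h := nneg_series_le n (fun k => sqr_ge0 (c k)) cc.
have := hN m Nm; rewrite [in X in X -> _]/series/= big_mkord => h2.
by apply: le_lt_trans h2; rewrite (le_trans _ (ler_norm _))// lerB.
Qed.

Lemma onb_series_ip (c : nat -> R) l :
  ip_cvg ip (fun n => \sum_(k < n) c k *: f k) l -> forall i, ip l (f i) = c i.
Proof.
move=> /ip_cvgP h i; apply: cvgn_unique (h (f i)) _.
apply: cvg_near_cst; exists i.+1 => //= n /= ni.
rewrite ip_suml (bigD1 (Ordinal ni))//= ipZl onb_ip eqxx mulr1 big1 ?addr0//.
by move=> j ji; rewrite ipZl onb_ip -[(j == i :> nat)]/(j == Ordinal ni) (negbTE ji) mulr0.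
Qed.

(** The representer has coefficients [F (f k)]. They are square-summable because the bound on [F],
    tested on the partial sum of [F (f k) *: f k] with squared norm [s], reads
    [s <= M' * sqrt s]. *)
Lemma onb_riesz : riesz ip.
Proof.
move=> F lF [M hM].
have F0 : F 0 = 0 by have := lF 1 0 0; rewrite scaler0 addr0 mul1r; lra.
have Fsum n (c : 'I_n -> R) :
    F (\sum_(k < n) c k *: f k) = \sum_(k < n) c k * F (f k).
  have FD x y : F (x + y) = F x + F y by have := lF 1 x y; rewrite scale1r mul1r.
  rewrite (big_morph F FD F0); apply: eq_bigr => k _.
  by have := lF (c k) (f k) 0; rewrite addr0 F0 addr0.
pose M' := Num.max M 0.
have hM' x : `|F x| <= M' * '|x|.
  by rewrite (le_trans (hM x))// ler_wpM2r ?ip_norm_ge0// le_max lexx.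
have M'0 : 0 <= M' by rewrite le_max lexx orbT.
have bnd n : \sum_(k < n) F (f k) ^+ 2 <= M' ^+ 2.
  set s := \sum_(k < n) _.
  have s0 : 0 <= s by apply: sumr_ge0 => k _; exact: sqr_ge0.
  have := hM' (\sum_(k < n) F (f k) *: f k).
  rewrite Fsum; under eq_bigr do rewrite -expr2.
  rewrite -/s ger0_norm// => h.
  have : s ^+ 2 <= M' ^+ 2 * s.
    rewrite [in leRHS]/s -(sum_onb_sqr (fun k => F (f k))) -exprMn.
    by rewrite ler_pXn2r// nnegrE// mulr_ge0 ?ip_norm_ge0.
  have [->|sn] := eqVneq s 0; first by rewrite sqr_ge0.
  by rewrite expr2 ler_pM2r// lt_neqAle eq_sym sn.
have cc : cvgn (series (fun n => F (f n) ^+ 2)).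
  exact: nneg_series_cvg (fun k => sqr_ge0 (F (f k))) bnd.
have [z hz] := onb_series_ex cc; exists z => x.
have hx : F (onb_proj n x) @[n --> \oo] --> F x.
  apply/cvgrPdistC_le => e e0.
  have d0 : 0 < e / (M' + 1) by rewrite divr_gt0// ltr_wpDl.
  have := @onb_proj_cvg x; move/cvgrPdist_le => /(_ _ d0); apply: filterS => n /=.
  rewrite sub0r normrN ger0_norm ?ip_norm_ge0// => h.
  have -> : F (onb_proj n x) - F x = F (onb_proj n x - x).
    by rewrite [in RHS]addrC -scaleN1r lF mulN1r addrC.
  rewrite (le_trans (hM' _))// (le_trans (ler_wpM2l M'0 h))//.
  rewrite mulrCA ler_piMr ?(ltW e0)// ler_pdivrMr ?mul1r ?lerDl ?ler01//.
  by rewrite ltr_wpDl.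
apply: cvgn_unique hx _.
have := @parseval x z; apply: cvg_trans; apply: near_eq_cvg; near=> n.
rewrite /onb_proj Fsum /series/= big_mkord; apply: eq_bigr => k _.
by rewrite (@onb_series_ip (fun k => F (f k)) _ hz).
Unshelve. all: by end_near. Qed.

End basis.
End theory.
End inner_product_space.

Lemma cvg_sum_ord {R : realType} (T : Type) (F : set_system T) {FF : Filter F} n
    (f : 'I_n -> T -> R) (l : 'I_n -> R) :
  (forall i, f i x @[x --> F] --> l i) ->
  \sum_(i < n) f i x @[x --> F] --> \sum_(i < n) l i.
Proof.
by move=> fl; apply: cvg_big => [|i _]; [exact: add_continuous|exact: fl].
Qed.

(** * Hilbert-Schmidt sums and independence of the trace from the basis *)

Section traces.
Context {R : realType} (U : lmodType R) (ip : U -> U -> R).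
Hypothesis ipP : inner_product ip.
Local Notation "''|' x |" := (ip_norm ip x) (at level 0, x at level 99).

Lemma adjoint_pair_linear (W : lmodType R) (ipW : W -> W -> R) (T : U -> W) T' :
  inner_product ipW ->
  (forall x y, ipW (T x) y = ip x (T' y)) ->
  forall a x y, T' (a *: x + y) = a *: T' x + T' y.
Proof.
move=> ipWP TT' a x y; apply: (ip_inj ipP) => z.
by rewrite -TT' (ipDr ipWP) (ipZr ipWP) !TT' (ipDr ipP) (ipZr ipP).
Qed.

(** One basis [f] must exist for two candidate values to be compared: if there were none, every real
    would satisfy the condition defining [trace]. *)
Lemma trace_unique (T : U -> U) t (f : nat -> U) : orthonormal_basis ip f ->
  (forall g, orthonormal_basis ip g ->
    series (fun n => ip (T (g n)) (g n)) @ \oo --> t) -> trace ip T = t.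
Proof.
move=> onf h; apply: xget_unique => // t' h'.
exact: cvgn_unique (h' _ onf) (h _ onf).
Qed.

Section double_sum.
Variables (T T' : U -> U).
Hypothesis TT' : forall x y, ip (T x) y = ip x (T' y).

(** Cutting the expansion of each [T' (g n)] after [M] terms makes both sums finite, hence
    exchangeable; Bessel for [T (f m)] along [g] bounds the result by [L], and [M] then goes to
    infinity. *)
Lemma hs_adjoint_le (f g : nat -> U) L N :
  orthonormal_basis ip f -> orthonormal_basis ip g ->
  series (fun n => '|T (f n)| ^+ 2) @ \oo --> L ->
  \sum_(n < N) '|T' (g n)| ^+ 2 <= L.
Proof.
move=> onf ong TL.
have h : \sum_(n < N) series (fun m => ip (T' (g n)) (f m) ^+ 2) M @[M --> \oo] -->
    \sum_(n < N) '|T' (g n)| ^+ 2.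
  by apply: cvg_sum_ord => n; exact: (parseval_sqr ipP onf).
rewrite -(cvg_lim _ h)//; apply: limr_le; first exact: cvgP h.
apply: nearW => M; rewrite /series/=.
under eq_bigr do rewrite big_mkord.
rewrite exchange_big/=; apply: le_trans (nneg_series_le M _ TL); last first.
  by move=> k; exact: sqr_ge0.
apply: ler_sum => m _.
rewrite (le_trans _ (bessel ipP ong (T (f m)) N))//; apply: ler_sum => n _.
by rewrite TT' (ipC ipP).
Qed.
End double_sum.

(* Exchanging the two sums in [\sum_(m, n) <T f_m, g_n>^2] shows that the
   Hilbert-Schmidt norm does not depend on the basis. *)
Lemma hs_adjoint_cvg (T T' : U -> U) (f g : nat -> U) :
  (forall x y, ip (T x) y = ip x (T' y)) ->
  orthonormal_basis ip f -> orthonormal_basis ip g ->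
  cvgn (series (fun n => '|T (f n)| ^+ 2)) ->
  series (fun n => '|T' (g n)| ^+ 2) @ \oo -->
    limn (series (fun n => '|T (f n)| ^+ 2)).
Proof.
move=> TT' onf ong cT.
have T'T x y : ip (T' x) y = ip x (T y).
  by rewrite (ipC ipP) -TT' (ipC ipP).
have cT' := nneg_series_cvg (fun k => sqr_ge0 '|T' (g k)|)
  (fun N => @hs_adjoint_le _ _ TT' f g _ N onf ong cT).
suff -> : limn (series (fun n => '|T (f n)| ^+ 2)) =
    limn (series (fun n => '|T' (g n)| ^+ 2)) by [].
apply/le_anti/andP; split; apply: limr_le => //; apply: nearW => N;
  rewrite /series/= big_mkord.
- exact: (hs_adjoint_le T'T N ong onf cT').
- exact: (hs_adjoint_le TT' N onf ong cT).
Qed.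

(* Polarization writes [<Phi Phi* C g, g>] as a difference of the squared norms
   [|Phi* (C g + g)|^2 / 4] and [|Phi* (C g - g)|^2 / 4]. *)
Lemma trace_hs_comp (Phi Psi C : U -> U) (K : R) (f : nat -> U) :
  (forall x y, ip (Phi x) y = ip x (Psi y)) ->
  (forall x y, ip (C x) y = ip x (C y)) ->
  (forall x, '|C x| <= K * '|x|) ->
  orthonormal_basis ip f -> cvgn (series (fun n => '|Phi (f n)| ^+ 2)) ->
  series (fun n => ip (C (Phi (f n))) (Phi (f n))) @ \oo -->
    trace ip (Phi \o Psi \o C).
Proof.
move=> PhiPsi Csym CK onf cPhi.
have Psilin := adjoint_pair_linear ipP PhiPsi.
have PsiD x y : Psi (x + y) = Psi x + Psi y by have := Psilin 1 x y; rewrite !scale1r.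
have Psi0 : Psi 0 = 0 by apply: (ip_inj ipP) => z; rewrite -PhiPsi !(ip0r ipP).
have PsiN x : Psi (- x) = - Psi x.
  by have := Psilin (-1) x 0; rewrite !scaleN1r Psi0 !addr0.
have K0 : 0 <= `|K| := normr_ge0 K.
have CK' x : '|C x| <= `|K| * '|x|.
  by rewrite (le_trans (CK x))// ler_wpM2r ?ip_norm_ge0// ler_norm.
(* The two signs of the polarization are [s = 1] and [s = -1]. Each operator [C Phi + s Phi] is
   Hilbert-Schmidt, its norms being at most [|K| + 1] times those of [Phi]. *)
have cT (s : R) : `|s| = 1 ->
    cvgn (series (fun n => '|C (Phi (f n)) + s *: Phi (f n)| ^+ 2)).
  move=> s1; apply: (nneg_series_cvg (M := (`|K| + 1) ^+ 2 *
      limn (series (fun n => '|Phi (f n)| ^+ 2)))) => [k|N]; first exact: sqr_ge0.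
  have := nneg_series_le N (fun k => sqr_ge0 '|Phi (f k)|) cPhi.
  move/(ler_wpM2l (sqr_ge0 (`|K| + 1))); apply: le_trans.
  rewrite mulr_sumr; apply: ler_sum => k _.
  rewrite -exprMn ler_pXn2r ?nnegrE ?ip_norm_ge0//; last first.
    by rewrite mulr_ge0 ?ip_norm_ge0// addr_ge0.
  rewrite (le_trans (ip_normD ipP _ _))// (ip_normZ ipP) s1 mul1r mulrDl mul1r.
  by rewrite lerD2r.
have adj (s : R) x y :
    ip (C (Phi x) + s *: Phi x) y = ip x (Psi (C y + s *: y)).
  rewrite -PhiPsi (ipDl ipP) (ipZl ipP) (ipDr ipP) (ipZr ipP) Csym; congr (_ + _).
pose t (s : R) := limn (series (fun n => '|C (Phi (f n)) + s *: Phi (f n)| ^+ 2)).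
have s1 : `|1 : R| = 1 by rewrite normr1.
have sN1 : `|-1 : R| = 1 by rewrite normrN1.
have comb (u v w : nat -> R) (lu lv : R) : (forall n, w n = 4^-1 * (u n - v n)) ->
    series u @ \oo --> lu -> series v @ \oo --> lv ->
    series w @ \oo --> 4^-1 * (lu - lv).
  move=> wE ul vl.
  rewrite (_ : series w = fun n => 4^-1 * (series u n - series v n)); last first.
    apply/funext => n; rewrite /series/= -sumrB mulr_sumr.
    by apply: eq_bigr => k _; rewrite wE.
  by apply: cvgMl_tmp; exact: cvgB.
(* The same number is reached from two sides: along [f] with [C Phi + s Phi], and along any basis
   [g] with the adjoints [Psi (C + s)], which have the same Hilbert-Schmidt norms. *)
suff -> : trace ip (Phi \o Psi \o C) = 4^-1 * (t 1 - t (-1)).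
  apply: (comb (fun n => '|C (Phi (f n)) + 1 *: Phi (f n)| ^+ 2)
               (fun n => '|C (Phi (f n)) + (-1) *: Phi (f n)| ^+ 2)); last 2 first.
  - exact: cT.
  - exact: cT.
  move=> n; rewrite !(ip_norm_sqr ipP) !(ipDl ipP, ipDr ipP, ipZl ipP, ipZr ipP).
  by rewrite (ipC ipP (Phi (f n)) (C _)); field.
apply: (trace_unique onf) => g ong.
apply: (comb (fun n => '|Psi (C (g n) + 1 *: g n)| ^+ 2)
             (fun n => '|Psi (C (g n) + (-1) *: g n)| ^+ 2)); last 2 first.
- exact: (hs_adjoint_cvg (adj 1) onf ong (cT 1 s1)).
- exact: (hs_adjoint_cvg (adj (-1)) onf ong (cT (-1) sN1)).
move=> n /=; rewrite PhiPsi scale1r scaleN1r !PsiD PsiN.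
rewrite !(ip_norm_sqr ipP) !(ipDl ipP, ipDr ipP, ipNl ipP, ipNr ipP).
by rewrite (ipC ipP (Psi (g n)) (Psi (C _))); field.
Qed.

End traces.

(** * The energy space: inner product, embedding into [H], Riesz property *)

Section energy.
Context (R : realType) (H : lmodType R) (ip : {dot H for idfun}).
Variables (e : nat -> H) (alpha : nat -> R).
Hypothesis he : orthonormal_basis ip e.
Hypothesis cH : ip_complete ip.
Hypothesis alpha_gt0 : forall n, 0 < alpha n.
Hypothesis alpha_infty : alpha n @[n --> \oo] --> +oo.

Let ipP : inner_product ip := dot_inner_product ip.
Let s n := Num.sqrt (alpha n).
Local Notation V := (energy_space ip e alpha).
Local Notation ipV := (@energy_ip R H ip e alpha).

(** Membership in the domain is square-summability of the coefficients, so the limit in [diag_op]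
    exists and is not the default value of [ip_lim]. *)
Lemma diag_op_ip c x k : diag_dom ip e c x ->
  ip (diag_op ip e c x) (e k) = c k * ip x (e k).
Proof.
move=> Dx; have [l hl] : exists l,
    ip_cvg ip (fun n => \sum_(k < n) (c k * ip x (e k)) *: e k) l.
  apply: (onb_series_ex ipP he cH (c := fun k => c k * ip x (e k))).
  by under eq_fun do rewrite exprMn.
rewrite /diag_op (ip_limP ipP hl).
exact: (onb_series_ip ipP he (c := fun k => c k * ip x (e k)) hl).
Qed.

Lemma diag_dom_onb c k : diag_dom ip e c (e k).
Proof.
apply: (nneg_series_cvg (M := c k ^+ 2)) => [n|N].
  by rewrite mulr_ge0 ?sqr_ge0.
have [kN|Nk] := ltnP k N.
  rewrite (bigD1 (Ordinal kN))//= (onb_ip he) eqxx expr1n mulr1 big1 ?addr0//.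
  move=> i ik; rewrite (onb_ip he) eq_sym -[(i == k :> nat)]/(i == Ordinal kN).
  by rewrite (negbTE ik) expr0n mulr0.
rewrite big1 ?sqr_ge0// => i _; rewrite (onb_ip he) gtn_eqF ?expr0n ?mulr0//.
exact: leq_trans (ltn_ord i) Nk.
Qed.

Lemma diag_dom0 c : diag_dom ip e c 0.
Proof. by apply/asboolP/(rpred0 (diag_pred ip e c)). Qed.

Lemma diag_dom_proj c n x : diag_dom ip e c (onb_proj ip e n x).
Proof.
apply/asboolP/(@rpred_sum _ (diag_pred ip e c)) => k _.
by apply: rpredZ; apply/asboolP; exact: diag_dom_onb.
Qed.

(** This is (-A)^{1/2}, an isometry from the first factor of [V] onto [H]. Its injectivity makes
    [energy_ip] definite and its surjectivity carries Riesz over to [V]. *)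
Definition energy_iso (x : half_space ip e alpha) : H :=
  diag_op ip e s (diag_val x).
Local Notation J := energy_iso.

Lemma energy_iso_ip x k : ip (J x) (e k) = s k * ip (diag_val x) (e k).
Proof. by apply: diag_op_ip; case: x => x /= /asboolP. Qed.

Lemma energy_iso_linear a x y : J (a *: x + y) = a *: J x + J y.
Proof.
apply: (onb_eq ipP he) => k.
rewrite energy_iso_ip !(ipDl ipP, ipZl ipP) !energy_iso_ip.
by ring.
Qed.

Lemma sqrt_alpha_gt0 k : 0 < s k. Proof. by rewrite sqrtr_gt0. Qed.

Lemma energy_iso_inj : injective J.
Proof.
move=> x y Jxy; apply/val_inj/(onb_eq ipP he) => k.
have := energy_iso_ip x k; rewrite Jxy energy_iso_ip => /mulfI ->//.
by rewrite gt_eqF// sqrt_alpha_gt0.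
Qed.

Lemma energy_iso0 : J 0 = 0.
Proof.
by have := energy_iso_linear (-1) 0 0; rewrite !scaleN1r addNr => ->; rewrite addNr.
Qed.

Lemma energy_inner_product : inner_product ipV.
Proof.
split=> [x y|a x y z|x x0].
- by rewrite /energy_ip (ipC ipP) (ipC ipP x.2).
- rewrite /energy_ip -![diag_op _ _ _ (diag_val _)]/(J _).
  have -> : (a *: x + y).1 = a *: x.1 + y.1 by [].
  have -> : (a *: x + y).2 = a *: x.2 + y.2 by [].
  by rewrite energy_iso_linear !(ipDl ipP, ipZl ipP); ring.
- rewrite lt_neqAle; apply/andP; split; last by rewrite addr_ge0 ?(ip_ge0 ipP).
  apply: contra x0; rewrite eq_sym /energy_ip paddr_eq0 ?(ip_ge0 ipP)//.
  move=> /andP[/eqP/(ip_eq0 ipP) x1 /eqP/(ip_eq0 ipP) x2].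
  apply/eqP; rewrite [x]surjective_pairing x2.
  by rewrite (_ : x.1 = 0)//; apply: energy_iso_inj; rewrite energy_iso0.
Qed.

(** Divergence leaves only finitely many [alpha n] below 1, and those have a positive minimum. The
    gap [m] makes (-A)^{-1/2} bounded. *)
Lemma alpha_lower_bound : exists2 m, 0 < m & forall n, m <= alpha n.
Proof.
move/cvgryPge : alpha_infty => /(_ 1) [N _ hN].
have hm : exists2 m, 0 < m & forall n, (n < N)%N -> m <= alpha n.
  elim: N {hN} => [|N [m m0 hm]]; first by exists 1.
  exists (Num.min m (alpha N)); first by rewrite lt_min m0 alpha_gt0.
  move=> n; rewrite ltnS leq_eqVlt => /predU1P[->|nN]; first by rewrite ge_min lexx orbT.
  by rewrite ge_min hm.
have [m m0 {}hm] := hm; exists (Num.min m 1); first by rewrite lt_min m0 ltr01.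
move=> n; have [nN|Nn] := ltnP n N; first by rewrite ge_min hm.
by rewrite ge_min (hN n Nn) orbT.
Qed.

(** The preimage has coefficients [ip y (e k) / s k], square-summable by the spectral gap;
    multiplied by [s k] they give back those of [y], so it lies in the domain. *)
Lemma energy_iso_surj y : exists x, J x = y.
Proof.
have [m m0 hm] := alpha_lower_bound.
have [|x hx] := onb_series_ex ipP he cH (c := fun k => ip y (e k) / s k).
  apply: (nneg_series_cvg (M := m^-1 * ip_norm ip y ^+ 2)) => [k|N].
    exact: sqr_ge0.
  apply: (le_trans (y := m^-1 * \sum_(k < N) ip y (e k) ^+ 2)); last first.
    by rewrite ler_wpM2l ?invr_ge0 ?(ltW m0)// (bessel ipP he).
  rewrite mulr_sumr; apply: ler_sum => k _.
  rewrite exprMn mulrC ler_wpM2r ?sqr_ge0// exprVn sqr_sqrtr ?(ltW (alpha_gt0 _))//.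
  by rewrite lef_pV2 ?posrE// alpha_gt0.
have xk k : ip x (e k) = ip y (e k) / s k.
  exact: (onb_series_ip ipP he (c := fun k => ip y (e k) / s k) hx).
have Dx : x \in diag_pred ip e s.
  apply/asboolP; rewrite /diag_dom/=.
  under eq_fun do rewrite xk -exprMn mulrCA divff ?gt_eqF ?sqrt_alpha_gt0// mulr1.
  exact: cvgP (@parseval_sqr _ _ _ ipP _ he y).
exists (DiagSpace Dx); apply: (onb_eq ipP he) => k.
by rewrite energy_iso_ip xk mulrCA divff ?mulr1// gt_eqF ?sqrt_alpha_gt0.
Qed.

(** A Poincaré inequality with constant [1 / sqrt m], obtained coefficient by coefficient. *)
Lemma diag_val_bounded : exists2 M, 0 <= M &
  forall x : V, ip_norm ip (diag_val x.1) <= M * ip_norm ipV x.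
Proof.
have [m m0 hm] := alpha_lower_bound.
exists (Num.sqrt m)^-1; first by rewrite invr_ge0 sqrtr_ge0.
move=> x; rewrite mulrC ler_pdivlMr ?sqrtr_gt0//.
rewrite -(@ler_pXn2r _ 2)// ?nnegrE ?mulr_ge0 ?ip_norm_ge0 ?sqrtr_ge0//.
rewrite (ip_norm_sqr energy_inner_product) exprMn (sqr_sqrtr (ltW m0)).
apply: (le_trans (y := ip (J x.1) (J x.1))); last by rewrite lerDl (ip_ge0 ipP).
rewrite -(ip_norm_sqr ipP).
have h : m * series (fun n => ip (diag_val x.1) (e n) ^+ 2) n @[n --> \oo] -->
    m * ip_norm ip (diag_val x.1) ^+ 2.
  by apply: cvgMl_tmp; exact: (parseval_sqr ipP he).
rewrite mulrC -(cvg_lim _ h)//; apply: limr_le; first exact: cvgP h.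
apply: nearW => n; rewrite (le_trans _ (bessel ipP he (J x.1) n))//.
rewrite /series/= big_mkord mulr_sumr; apply: ler_sum => k _.
rewrite energy_iso_ip exprMn sqr_sqrtr ?(ltW (alpha_gt0 _))//.
by rewrite ler_wpM2r ?sqr_ge0.
Qed.

Lemma diag_op0 : diag_op ip e (fun n => Num.sqrt (alpha n)) 0 = 0.
Proof. exact: energy_iso0. Qed.

Lemma energy_norm_inr v : ip_norm ipV (0, v) = ip_norm ip v.
Proof.
by rewrite /ip_norm /energy_ip/= diag_op0 (ip0l ipP) add0r.
Qed.

Lemma energy_ip_inr v x : ipV (0, v) x = ip v x.2.
Proof.
by rewrite /energy_ip/= diag_op0 (ip0l ipP) add0r.
Qed.

Lemma energy_norm_snd (x : V) : ip_norm ip x.2 <= ip_norm ipV x.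
Proof. by rewrite /ip_norm ler_wsqrtr// lerDr (ip_ge0 ipP). Qed.

(** The functional is represented on each factor separately by Riesz in [H]; on the first factor it
    is pulled back along the inverse [I] of [energy_iso]. *)
Lemma energy_riesz : riesz ipV.
Proof.
move=> F lF [M hM].
have /choice[I hI] := energy_iso_surj.
have Ilin a x y : I (a *: x + y) = a *: I x + I y.
  by apply: energy_iso_inj; rewrite energy_iso_linear !hI.
have [z1 hz1] : exists z, forall x, F (I x, 0) = ip x z.
  apply: (onb_riesz ipP he cH) => [a x y|].
    by rewrite -lF Ilin; congr F; apply: injective_projections; rewrite /= ?scaler0 ?addr0.
  exists M => x; rewrite (le_trans (hM _))// /ip_norm /energy_ip/=.
  by rewrite -[diag_op _ _ _ _]/(J (I x)) hI (ip0l ipP) addr0.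
have [z2 hz2] : exists z, forall x, F (0, x) = ip x z.
  apply: (onb_riesz ipP he cH) => [a x y|].
    by rewrite -lF; congr F; apply: injective_projections; rewrite /= ?scaler0 ?addr0.
  by exists M => x; rewrite (le_trans (hM _))// energy_norm_inr.
exists (I z1, z2) => -[x1 x2].
have split_x : (x1, x2) = 1 *: (I (J x1), 0) + (0, x2) :> V; last first.
  by rewrite [in LHS]split_x lF hz1 hz2 mul1r -[in LHS](hI z1).
rewrite scale1r; apply: injective_projections; rewrite /= ?addr0 ?add0r//.
by apply: energy_iso_inj; rewrite hI.
Qed.

(* [p u] is [((-A)^{-1} u, 0)]. *)
Lemma fst_adjoint_ex : exists p : H -> V,
  forall x u, ip (diag_val x.1) u = ipV x (p u).
Proof.
have [M M0 hM] := diag_val_bounded.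
suff /choice[p hp] u : exists z, forall x : V, ip (diag_val x.1) u = ipV x z.
  by exists p => x u; rewrite hp.
apply: energy_riesz => [a x y|].
  have -> : diag_val (a *: x + y).1 = a *: diag_val x.1 + diag_val y.1 by [].
  by rewrite (ipDl ipP) (ipZl ipP).
exists (M * ip_norm ip u) => x.
rewrite (le_trans (cauchy_schwarz ipP _ _))// mulrAC ler_wpM2r ?ip_norm_ge0//.
Qed.

(** Finite combinations of the [e k] lie in every diagonal domain, which an arbitrary [v] does not;
    this makes the generator available on projected vectors. *)
Lemma wave_dom_inr n v : wave_dom ip e alpha (0, onb_proj ip e n v).
Proof. by split; [exact: diag_dom0|exact: diag_dom_proj]. Qed.

Lemma wave_op_fst a b x : wave_dom ip e alpha x ->
  diag_val (wave_op ip e alpha a b x).1 = x.2.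
Proof. by case=> _ x2; rewrite /wave_op/= insubdK//; apply/asboolP. Qed.

End energy.

(** * Completeness of L^2 (Riesz-Fischer) *)

Section L2_complete.
Context d (T : measurableType d) (R : realType) (mu : {measure set T -> \bar R}).
Local Notation Lfun2 := (LfunType mu (lee1n 2)).

Lemma Lfun2_sqr (f : T -> R) : measurable_fun [set: T] f ->
  (\int[mu]_x (f x ^+ 2)%:E < +oo)%E -> f \in Lfun mu 2%:E.
Proof.
move=> mf foo; rewrite inE; apply/andP; split; rewrite inE//=.
rewrite /finite_norm unlock; apply: poweR_lty.
rewrite (_ : (\int[mu]_x _)%E = (\int[mu]_x (f x ^+ 2)%:E)%E)//.
apply: eq_integral => x _ /=.
by rewrite powR_mulrn// -normrX ger0_norm// sqr_ge0.
Qed.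

Lemma L2_inner_product : inner_product (L2_ip mu).
Proof. exact: dot_inner_product. Qed.

Lemma L2_ip_sqr (f : Lfun2) :
  ((ip_norm (L2_ip mu) (\pi_(L2 mu) f)%qT ^+ 2)%:E = \int[mu]_x (f x ^+ 2)%:E)%E.
Proof.
rewrite (ip_norm_sqr L2_inner_product) L2_ipE /Rintegral fineK.
  by apply: eq_integral => x _; rewrite /= expr2.
exact: integrable_fin_num (L2_mul_integrable f f).
Qed.

Lemma pi_subE (f g : Lfun2) :
  ((\pi_(L2 mu) f - \pi_(L2 mu) g)%R = \pi_(L2 mu) (f - g)%R)%qT.
Proof. by rewrite !piE. Qed.


Lemma limn_einf_le (v : nat -> \bar R) c :
  (\forall k \near \oo, v k <= c)%E -> (limn_einf v <= c)%E.
Proof.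
move=> vc; rewrite limn_einf_lim; apply: lime_le; first exact: is_cvg_einfs.
apply: filterS vc => k; apply: le_trans; apply: ereal_inf_lbound.
by exists k => /=.
Qed.

Lemma geometric_steps_cvg (v : nat -> R) (c : R) :
  (forall k, `|v k.+1 - v k| <= c * 2^-1 ^+ k) -> cvgn v.
Proof.
move=> vc; have c0 : 0 <= c by have := vc 0%N; rewrite expr0 mulr1; exact: le_trans.
have -> : v = fun n => v 0%N + series (telescope v) n.
  by apply/funext => n; exact: eq_sum_telescope.
apply: is_cvgD; first exact: is_cvg_cst.
apply: normed_cvg; apply: (@series_le_cvg _ _ (geometric c 2^-1)) => [n|n|n|].
- exact: normr_ge0.
- by rewrite /geometric/= mulr_ge0// exprn_ge0.
- exact: vc.
- by apply: is_cvg_geometric_series; rewrite ger0_norm//; lra.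
Qed.

(* Along a subsequence [U_k] with [\int |U_{k+1} - U_k|^2 <= 8^{-k}/2], the sum
   [\sum_k 4^k |U_{k+1} - U_k|^2] is integrable, hence finite a.e., which makes
   the steps geometric; Fatou's lemma turns the a.e. limit into an L^2 limit. *)
Lemma L2_complete : ip_complete (L2_ip mu).
Proof.
move=> u cu.
pose U n : Lfun2 := repr (u n).
have uU n : u n = (\pi_(L2 mu) (U n))%qT by rewrite reprK.
pose I (f : T -> R) := (\int[mu]_x (f x ^+ 2)%:E)%E.
have mU n : measurable_fun [set: T] (U n) by [].
have cI c : 0 < c -> exists N, forall m n, (N <= m)%N -> (N <= n)%N ->
    (I (fun x => U m x - U n x)%R <= c%:E)%E.
  move=> c0; have e0 : 0 < Num.sqrt c by rewrite sqrtr_gt0.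
  have [N hN] := cu _ e0; exists N => m n Nm Nn.
  rewrite (_ : I _ = (ip_norm (L2_ip mu) (u m - u n) ^+ 2)%:E).
    rewrite lee_fin -(sqr_sqrtr (ltW c0)) ler_pXn2r ?nnegrE ?ip_norm_ge0 ?(ltW e0)//.
    by rewrite ltW// hN.
  by rewrite !uU pi_subE L2_ip_sqr.
(* The factor [4 ^- k] cancels the weight [4 ^+ k] of the series [G]; the remaining [1 / 2 ^ k.+1]
   has the shape summed by [epsilon_trick0]. *)
have /choice[N_ hN] (k : nat) : exists N, forall m n, (N <= m)%N -> (N <= n)%N ->
    (I (fun x => U m x - U n x)%R <= (4 ^- k * (1 / (2 ^ k.+1)%:R))%:E)%E.
  by apply: cI; rewrite mulr_gt0 ?invr_gt0 ?exprn_gt0// divr_gt0// ltr0n expn_gt0.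
(* Cumulative sums of successors give indices that are strictly increasing and at least [N_ k]. *)
pose n_ k := (\sum_(i < k.+1) (N_ i).+1)%N.
have Nn k : (N_ k <= n_ k)%N by rewrite /n_ big_ord_recr/= addnS ltnW// ltnS leq_addl.
have n_S k : (n_ k < n_ k.+1)%N by rewrite /n_ [ltnRHS]big_ord_recr/= addnS ltnS leq_addr.
have n_ge k : (k <= n_ k)%N by elim: k => // k IH; exact: leq_ltn_trans IH (n_S k).
pose dl k x : R := U (n_ k.+1) x - U (n_ k) x.
have mdl k : measurable_fun [set: T] (dl k) by exact: measurable_funB.
pose G x : \bar R := (\sum_(k <oo) (4 ^+ k * dl k x ^+ 2)%:E)%E.
have t0 k x : (0 <= (4 ^+ k * dl k x ^+ 2)%:E)%E.
  by rewrite lee_fin mulr_ge0 ?sqr_ge0 ?exprn_ge0.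
have mt k : measurable_fun [set: T] (fun x => (4 ^+ k * dl k x ^+ 2)%:E).
  by apply/measurable_EFinP; apply: measurable_funM => //; exact: measurable_funX.
have mG : measurable_fun [set: T] G.
  exact: ge0_emeasurable_sum.
have iG : (\int[mu]_x G x < +oo)%E.
  rewrite integral_nneseries//; apply: (@le_lt_trans _ _ (1%:E)%E); last by rewrite ltry.
  apply: le_trans (epsilon_trick0 xpredT ler01).
  apply: lee_nneseries => [k _ _|k _]; first by apply: integral_ge0 => x _.
  under eq_integral do rewrite EFinM.
  rewrite ge0_integralZl//; last 2 first.
  - by apply/measurable_EFinP; exact: measurable_funX.
  - by move=> x _; rewrite lee_fin sqr_ge0.
  rewrite (@le_trans _ _ ((4 ^+ k)%:E * (4 ^- k * (1 / (2 ^ k.+1)%:R))%:E)%E)//.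
    rewrite lee_wpmul2l ?lee_fin ?exprn_ge0// hN// ?Nn//.
    by rewrite (leq_trans (Nn k))// ltnW.
  by rewrite -EFinM mulVKf// expf_neq0.
have Gfin : {ae mu, forall x, G x \is a fin_num}.
  have : {ae mu, forall x, [set: T] x -> G x \is a fin_num}.
    apply: integrable_ae => //; apply/integrableP; split => //.
    under eq_integral do rewrite gee0_abs ?nneseries_ge0//.
    exact: iG.
  by apply: filterS => x; exact.
(* The upper limit is defined and measurable everywhere; it is the actual limit wherever [G] is
   finite. *)
pose L x := fine (limn_esup (fun k => (U (n_ k) x)%:E)).
have mL : measurable_fun [set: T] L.
  apply: measurableT_comp => //; apply: measurable_fun_limn_esup => k.
  exact/measurable_EFinP.
have UL : {ae mu, forall x, U (n_ k) x @[k --> \oo] --> L x}.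
  apply: filterS Gfin => x Gx.
  have cx : cvgn (fun k => U (n_ k) x).
    have g0 : 0 <= fine (G x) by rewrite fine_ge0// nneseries_ge0.
    (* A single term of [G x] bounds the step by [sqrt (G x) / 2 ^ k], and [G x + 1] dominates the
       square root. *)
    apply: (@geometric_steps_cvg _ (fine (G x) + 1)) => k.
    have h : 4 ^+ k * dl k x ^+ 2 <= fine (G x).
      rewrite -lee_fin fineK//.
      apply: le_trans (nneseries_lim_ge k.+1 (fun n _ _ => t0 n x)).
      by rewrite big_nat_recr//= leeDr// sume_ge0.
    rewrite exprVn ler_pdivlMr ?exprn_gt0// -(@ler_pXn2r _ 2)// ?nnegrE; last 2 first.
    - by rewrite mulr_ge0// exprn_ge0.
    - by rewrite addr_ge0.
    rewrite exprMn real_normK ?num_real// mulrC -exprM mulnC exprM.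
    rewrite (_ : 2 ^+ 2 = 4) ?expr2; last by ring.
    by rewrite (le_trans h)//; nra.
  have ex : (fun k => (U (n_ k) x)%:E) @ \oo --> (limn (fun k => U (n_ k) x))%:E.
    by apply: cvg_EFin; [exact: nearW|exact: cx].
  by rewrite /L (cvg_limn_einf_sup ex).2.
have IL c : 0 < c -> exists N, forall m, (N <= m)%N ->
    (I (fun x => L x - U m x)%R <= c%:E)%E.
  move=> c0; have [N cN] := cI _ c0; exists N => m Nm.
  have mD k : measurable_fun [set: T] (fun x => ((U (n_ k) x - U m x) ^+ 2)%:E).
    by apply/measurable_EFinP; apply: measurable_funX; exact: measurable_funB.
  have D0 k x : [set: T] x -> (0 <= ((U (n_ k) x - U m x) ^+ 2)%:E)%E.
    by rewrite lee_fin sqr_ge0.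
  have := fatou mu measurableT mD D0 => /le_trans -/(_ c%:E) h.
  apply: le_trans (h _); last first.
    by apply: limn_einf_le; exists N => // k /= Nk; rewrite cN// (leq_trans Nk).
  apply: ae_ge0_le_integral => //.
  - by move=> x _; rewrite lee_fin sqr_ge0.
  - by apply/measurable_EFinP; apply: measurable_funX; exact: measurable_funB.
  - move=> x _; rewrite limn_einf_lim; apply: lime_ge; first exact: is_cvg_einfs.
    by apply: nearW => k; apply: le_ereal_inf_tmp => _ [j _ <-]; exact: D0.
  - rewrite /limn_einf; apply: measurableT_comp => //.
    by apply: measurable_fun_limn_esup => k; exact: measurableT_comp.
  - apply: filterS UL => x ULx _.
    rewrite (_ : limn_einf _ = ((L x - U m x) ^+ 2)%:E)//.
    apply: (cvg_limn_einf_sup _).1; apply: cvg_EFin; first exact: nearW.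
    have ULm : U (n_ k) x - U m x @[k --> \oo] --> L x - U m x.
      by apply: cvgB => //; exact: cvg_cst.
    by rewrite expr2; under eq_fun do rewrite /= expr2; exact: cvgM.
have [N0 hN0] := IL 1 ltr01.
have LU : (L \- U N0) \in Lfun mu 2%:E.
  apply: Lfun2_sqr; first exact: measurable_funB.
  by apply: le_lt_trans (hN0 _ (leqnn _)) _; exact: ltry.
(* Only the difference [L - U N0] is known to be square-integrable, so [L] enters L^2 by adding
   [U N0] back. *)
pose Lf : Lfun2 := (Lfun_Sub (lee1n 2) LU + U N0)%R.
have LfE x : Lf x = L x by rewrite /= -[RHS](subrK (U N0 x)).
exists (\pi_(L2 mu) Lf)%qT; apply/cvgrPdist_le => eps e0.
have [N hIN] := IL _ (exprn_gt0 2 e0); exists N => // m /= Nm.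
rewrite sub0r normrN ger0_norm ?ip_norm_ge0// (ip_normB L2_inner_product).
rewrite -(@ler_pXn2r _ 2)// ?nnegrE ?ip_norm_ge0 ?(ltW e0)//.
rewrite -lee_fin uU pi_subE L2_ip_sqr (le_trans _ (hIN m Nm))//.
rewrite le_eqVlt; apply/orP; left; apply/eqP; apply: eq_integral => x _.
by rewrite -LfE.
Qed.

End L2_complete.

(** The function is [k / c] times the density of the exponential law. *)
Lemma expR_integrable {R : realType} (c k : R) : 0 < c ->
  (@lebesgue_measure R).-integrable `[0, +oo[ (fun t => (k * expR (- c * t))%:E).
Proof.
move=> c0.
have ipdf : (@lebesgue_measure R).-integrable `[0, +oo[ (EFin \o exponential_pdf c).
  by apply: integrableS (integrable_exponential_pdf c0).
have : (@lebesgue_measure R).-integrable `[0, +oo[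
    (fun t => (k / c)%:E * (exponential_pdf c t)%:E)%E by exact: integrableZl.
apply: eq_integrable => // t /[!inE]/=; rewrite in_itv/= andbT => t0.
by rewrite -EFinM exponential_pdfE// mulrA divfK// gt_eqF.
Qed.

Section adjoints.
Context {R : realType} (U W : lmodType R).
Variables (ipU : U -> U -> R) (ipW : W -> W -> R).
Hypotheses (ipUP : inner_product ipU) (ipWP : inner_product ipW).

Lemma adjoint_eq (T : U -> W) y z :
  (forall x, ipW (T x) y = ipU x z) -> adjoint ipU ipW T y = z.
Proof.
move=> h; apply: xget_unique => // z' h'; apply: (ip_inj ipUP) => x.
by rewrite -h'.
Qed.

Lemma adjointP (T : {linear U -> W}) : riesz ipU -> bounded_op ipU ipW T ->
  forall x y, ipW (T x) y = ipU x (adjoint ipU ipW T y).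
Proof.
move=> rU [M hM] x y.
have [a x1 x2||z hz] := rU (fun x => ipW (T x) y).
- by rewrite linearP (ipDl ipWP) (ipZl ipWP).
- exists (M * ip_norm ipW y) => x1; rewrite (le_trans (cauchy_schwarz ipWP _ _))//.
  by rewrite mulrAC ler_wpM2r ?ip_norm_ge0.
- by rewrite (adjoint_eq hz).
Qed.

(** Pairing at [x = T' y] gives [|T' y|^2 <= K |T' y| |y|]; then divide by [|T' y|]. *)
Lemma adjoint_pair_bounded (T : U -> W) (T' : W -> U) K : 0 <= K ->
  (forall x y, ipW (T x) y = ipU x (T' y)) ->
  (forall x, ip_norm ipW (T x) <= K * ip_norm ipU x) ->
  forall y, ip_norm ipU (T' y) <= K * ip_norm ipW y.
Proof.
move=> K0 TT' TK y; have [->|T'y] := eqVneq (ip_norm ipU (T' y)) 0.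
  by rewrite mulr_ge0 ?ip_norm_ge0.
rewrite -(@ler_pM2l _ (ip_norm ipU (T' y))) ?lt_neqAle 1?eq_sym ?T'y ?ip_norm_ge0//.
rewrite -expr2 (ip_norm_sqr ipUP) -TT' (le_trans (ip_le_norm ipWP _ _))//.
by rewrite mulrA [in leRHS](mulrC _ K) ler_wpM2r ?ip_norm_ge0.
Qed.

End adjoints.

(** * Continuity and differentiability of semigroup trajectories *)

Section semigroup.
Context {R : realType} (V : lmodType R) (ipV : V -> V -> R).
Hypotheses (ipVP : inner_product ipV) (rV : riesz ipV).
Variable S : R -> {linear V -> V}.
Hypothesis hS : C0_semigroup ipV S.
Variables (M omega : R).
Hypotheses (M0 : 0 <= M) (omega0 : 0 < omega).
Hypothesis SM : forall (t : R) (x : V), 0 <= t ->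
  ip_norm ipV (S t x) <= M * expR (- omega * t) * ip_norm ipV x.
Local Notation "''|' x |" := (ip_norm ipV x) (at level 0, x at level 99).

Lemma semigroup_bounded (t : R) x : 0 <= t -> '|S t x| <= M * '|x|.
Proof.
move=> t0; rewrite (le_trans (SM x t0))// ler_wpM2r ?ip_norm_ge0//.
by rewrite ler_piMr// -expR0 ler_expR mulNr oppr_le0 mulr_ge0// ltW.
Qed.

(** Factoring out [S s] reduces continuity at all times to right continuity at 0. *)
Lemma semigroup_shift (s t : R) z : 0 <= s -> s <= t ->
  '|S t z - S s z| <= M * '|S (t - s) z - z|.
Proof.
move=> s0 st; case: hS => _ _ Sadd _.
have {1}-> : t = s + (t - s) by rewrite addrC subrK.
by rewrite Sadd// ?subr_ge0// -linearB semigroup_bounded.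
Qed.

Lemma semigroup_modulus z e : 0 < e -> exists2 d, 0 < d &
  forall s t : R, 0 <= s -> 0 <= t -> `|s - t| < d -> '|S s z - S t z| <= e.
Proof.
move=> e0; case: hS => _ S0 _ /(_ z) Scvg.
have e'0 : 0 < e / (M + 1) by rewrite divr_gt0// ltr_wpDl.
have M1 : 0 < M + 1 by rewrite ltr_wpDl.
have := Scvg; move/cvgrPdist_le => /(_ _ e'0) [d /= d0 hd].
exists d => //.
have H s t : 0 <= s -> s <= t -> t - s < d -> '|S t z - S s z| <= e.
  move=> s0 st td; rewrite (le_trans (semigroup_shift z s0 st))//.
  have [/eqP|ts] := eqVneq (t - s) 0.
    by move=> /eqP ->; rewrite S0 subrr (ip_norm0 ipVP) mulr0 ltW.
  have ts0 : 0 < t - s by rewrite lt_neqAle eq_sym ts subr_ge0.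
  have := hd (t - s); rewrite /= !sub0r !normrN (gtr0_norm ts0) => /(_ td ts0).
  rewrite ger0_norm ?ip_norm_ge0// => h.
  rewrite (le_trans (ler_wpM2l M0 h))// mulrCA ler_piMr ?(ltW e0)//.
  by rewrite ler_pdivrMr// mul1r lerDl.
move=> s t s0 t0; have [st|ts] := leP s t => h.
  by rewrite (ip_normB ipVP) H//; move: h; rewrite distrC ger0_norm ?subr_ge0.
by rewrite H ?(ltW ts)//; move: h; rewrite gtr0_norm ?subr_gt0.
Qed.

(** Nothing is known of [S] at negative times. Freezing the trajectory there makes it continuous on
    the whole line, as used for measurability and for the fundamental theorem of calculus. *)
Definition traj z y (t : R) : R := ipV (S (Num.max t 0) z) y.

Lemma trajE z y (t : R) : 0 <= t -> traj z y t = ipV (S t z) y.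
Proof. by move=> t0; rewrite /traj max_l. Qed.

Lemma traj_continuous z y : continuous (traj z y).
Proof.
move=> t; apply/cvgrPdist_le => e e0.
have y1 : 0 < '|y| + 1 by rewrite ltr_wpDl ?ip_norm_ge0.
have [d d0 hd] := semigroup_modulus z (divr_gt0 e0 y1).
exists d => //= s ts; rewrite /traj -(ipBl ipVP).
rewrite (le_trans (cauchy_schwarz ipVP _ _))//.
rewrite (le_trans (ler_wpM2r (ip_norm_ge0 _ _) (hd _ _ _ _ _)))//.
- by rewrite le_max lexx orbT.
- by rewrite le_max lexx orbT.
- apply: le_lt_trans ts; have ts := ler_norm (t - s).
  have := ler_norm (s - t); rewrite distrC => st; rewrite ler_norml.
  by case: (leP t 0) => t0; case: (leP s 0) => s0; lra.
rewrite -mulrA ler_piMr ?(ltW e0)// mulrC ler_pdivrMr// mul1r lerDl//.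
Qed.

(* A one-sided generator limit at [0] gives a two-sided derivative at [t > 0]. *)
Lemma traj_is_derive (z z' y : V) (t : R) : 0 < t ->
  '|h^-1 *: (S h z - z) - z'| @[h --> 0^'+] --> (0 : R) ->
  is_derive t 1 (traj z y) (traj z' y t).
Proof.
move=> t0 zz'.
(* First-order expansion from [s] to [r], with [S s] factored out. It serves from [t] for positive
   increments and from [t + h] for negative ones; the latter gives the derivative at [t + h], which
   continuity of [traj z' y] moves to [t]. *)
have main (s r : R) : 0 <= s -> s < r ->
    `|traj z y r - traj z y s - (r - s) * traj z' y s| <=
    (r - s) * (M * '|(r - s)^-1 *: (S (r - s) z - z) - z'| * '|y|).
  move=> s0 sr; have rs0 : 0 < r - s by rewrite subr_gt0.
  rewrite !trajE ?(le_trans s0 (ltW sr))//.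
  rewrite -(ipZl ipVP) -!(ipBl ipVP) (le_trans (cauchy_schwarz ipVP _ _))//.
  rewrite mulrA ler_wpM2r ?ip_norm_ge0//.
  case: hS => _ _ Sadd _.
  have {1}-> : r = s + (r - s) by rewrite addrC subrK.
  rewrite Sadd// ?(ltW rs0)// -linearB -linearZ -linearB.
  rewrite (le_trans (semigroup_bounded _ s0))// mulrCA ler_wpM2l//.
  rewrite -[X in _ <= X * _](gtr0_norm rs0) -(ip_normZ ipVP) scalerBr scalerA.
  by rewrite divff ?gt_eqF// scale1r.
suff h : h^-1 *: (traj z y (h *: 1 + t) - traj z y t) @[h --> 0^'] -->
    traj z' y t.
  by apply: DeriveDef; [exact: cvgP h|exact: cvg_lim h].
apply/cvgrPdist_le => e e0.
have C0 : 0 < M * '|y| + 1 by rewrite ltr_wpDl ?mulr_ge0 ?ip_norm_ge0.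
have e2 : 0 < e / 2 by rewrite divr_gt0.
have e'0 : 0 < e / 2 / (M * '|y| + 1) by rewrite divr_gt0.
have := zz'; move/cvgrPdist_le => /(_ _ e'0) [d1 /= d10 hd1].
have := @traj_continuous z' y t; move/cvgrPdist_le => /(_ _ e2) [d2 /= d20 hd2].
(* The bound by [t] keeps [t + h] positive. *)
exists (Num.min d1 (Num.min d2 t)) => /=; first by rewrite !lt_min d10 d20 t0.
move=> h /=; rewrite sub0r normrN !lt_min => /and3P[hd1' hd2' ht] h0.
rewrite /GRing.scale/= mulr1.
have rho (k : R) : 0 < k -> k < d1 ->
    M * '|k^-1 *: (S k z - z) - z'| * '|y| <= e / 2.
  move=> k0 kd1; have := hd1 k; rewrite /= !sub0r !normrN gtr0_norm// => /(_ kd1 k0).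
  rewrite ger0_norm ?ip_norm_ge0// => hk.
  rewrite mulrAC (le_trans (ler_wpM2l _ hk)) ?mulr_ge0 ?ip_norm_ge0//.
  by rewrite mulrCA ler_piMr ?(ltW e2)// ler_pdivrMr// mul1r lerDl.
have [hpos|hneg] := ltP 0 h.
  have := main t (h + t) (ltW t0); rewrite ltrDr addrK => /(_ hpos) hm.
  rewrite (gtr0_norm hpos) in hd1'; have hr := rho h hpos hd1'.
  rewrite (_ : traj z' y t - h^-1 * _ =
      - (h^-1 * (traj z y (h + t) - traj z y t - h * traj z' y t))); last first.
    by field; rewrite gt_eqF.
  rewrite normrN normrM normfV (gtr0_norm hpos) mulrC ler_pdivrMr// [leRHS]mulrC.
  rewrite (le_trans hm)// ler_wpM2l ?(ltW hpos)// (le_trans hr)//.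
  by rewrite ler_pdivrMr// ler_peMr ?(ltW e0)//; lra.
have {}hneg : h < 0 by rewrite lt_neqAle h0.
rewrite (ltr0_norm hneg) in hd1' hd2' ht.
have k0 : 0 < - h by rewrite oppr_gt0.
have th : t - (h + t) = - h by ring.
have := main (h + t) t; rewrite th -subr_gt0 th => /(_ _ k0) hm.
have {}hm := hm (ltac:(lra)).
have hr := rho _ k0 hd1'.
have hc : `|traj z' y t - traj z' y (h + t)| <= e / 2.
  by apply: hd2; rewrite /= th gtr0_norm.
rewrite (_ : traj z' y t - h^-1 * _ = (traj z' y t - traj z' y (h + t)) +
    (- h)^-1 * - (traj z y t - traj z y (h + t) - - h * traj z' y (h + t))); last first.
  by field; rewrite lt_eqF.
rewrite (le_trans (ler_normD _ _))// [leRHS](splitr e) lerD//.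
rewrite normrM normrN normfV (gtr0_norm k0) mulrC ler_pdivrMr// [leRHS]mulrC.
by rewrite (le_trans hm)// ler_wpM2l ?(ltW k0).
Qed.

End semigroup.

Section positive_integral.
Context {R : realType}.
Local Notation mu := (@lebesgue_measure R).

(** The integrand [f] is not assumed continuous; the continuous [g] with [g^2 <= C f] keeps it away
    from zero on an interval to the right of [t0], which stays inside the half-line even when
    [t0 = 0]. *)
Lemma Rintegral_gt0 (f g : R -> R) (C t0 : R) : 0 <= t0 ->
  mu.-integrable `[0, +oo[ (fun t => (f t)%:E) ->
  continuous g -> (forall t, 0 <= t -> g t ^+ 2 <= C * f t) ->
  (forall t, 0 <= t -> 0 <= f t) -> g t0 != 0 ->
  0 < Rintegral mu `[0, +oo[ f.
Proof.
move=> t00 intf gcont gf f0 gt0.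
have C1 : 0 < Num.max C 0 + 1 by rewrite ltr_wpDl// le_max lexx orbT.
pose c := (g t0 / 2) ^+ 2 / (Num.max C 0 + 1).
have c0 : 0 < c by rewrite divr_gt0// exprn_even_gt0//= mulf_neq0// invr_neq0.
have g20 : 0 < `|g t0| / 2 by rewrite divr_gt0// normr_gt0.
have := gcont t0; move/cvgrPdist_lt => /(_ _ g20) [d /= d0 hd].
have d2 : 0 < d / 2 by rewrite divr_gt0.
have lower t : t0 <= t -> t <= t0 + d / 2 -> c <= f t.
  move=> tt0 td; have t_ge0 : 0 <= t := le_trans t00 tt0.
  have h : `|g t0 - g t| < `|g t0| / 2.
    by apply: hd; rewrite /= distrC ger0_norm ?subr_ge0//; lra.
  have h2 : `|g t0| / 2 <= `|g t|.
    by have := ler_normD (g t0 - g t) (g t); rewrite subrK; lra.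
  rewrite /c ler_pdivrMr// [leRHS]mulrC (le_trans (y := C * f t))//; last first.
    rewrite ler_wpM2r ?f0// (le_trans (y := Num.max C 0)) ?lerDl//.
    by rewrite le_max lexx.
  apply: le_trans (gf _ t_ge0).
  rewrite -[leLHS]real_normK ?num_real// -[leRHS]real_normK ?num_real//.
  by rewrite ler_pXn2r ?nnegrE// normrM (@ger0_norm _ 2^-1).
pose A := [set` `[0, +oo[] : set R.
pose B := [set` `[t0, t0 + d / 2]] : set R.
have BA : B `<=` `[0, +oo[.
  by move=> t; rewrite /B /= !in_itv/= andbT => /andP[h _]; exact: le_trans h.
have intB : mu.-integrable B (fun t => (f t)%:E).
  by apply: integrableS intf => //; exact: measurable_itv.
have muB : mu B = (d / 2)%:E.
  by rewrite /B lebesgue_measure_itv/= lte_fin ltrDl d2 -EFinD addrAC subrr add0r.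
have intf_fin : (\int[mu]_(t in A) (f t)%:E)%E \is a fin_num.
  exact: integrable_fin_num intf.
rewrite -lte_fin /Rintegral fineK//.
apply: (@lt_le_trans _ _ (\int[mu]_(t in B) c%:E)%E).
  have -> : (\int[mu]_(t in B) c%:E)%E = (c%:E * mu B)%E.
    by apply: integral_cst; exact: measurable_itv.
  by rewrite muB -EFinM lte_fin mulr_gt0.
apply: (@le_trans _ _ (\int[mu]_(t in B) (f t)%:E)%E).
  apply: ge0_le_integral => //.
  - exact: measurable_itv.
  - by move=> t _; rewrite lee_fin ltW.
  - exact: measurable_int intB.
  - by move=> t; rewrite /B/= in_itv/= => /andP[h1 h2]; rewrite lee_fin lower.
apply: ge0_subset_integral => //.
- exact: measurable_itv.
- exact: measurable_int intf.
- by move=> t; rewrite /= in_itv/= andbT => t_ge0; rewrite lee_fin f0.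
Qed.

End positive_integral.

(** * The Gramian form and its approximation by finite sums of trajectories *)

Section gramian.
Context {R : realType} (H V : lmodType R) (ip : H -> H -> R) (ipV : V -> V -> R).
Hypotheses (ipP : inner_product ip) (ipVP : inner_product ipV) (rV : riesz ipV).
Variable S : R -> {linear V -> V}.
Hypothesis hS : C0_semigroup ipV S.
Variables (M omega : R).
Hypotheses (M0 : 0 <= M) (omega0 : 0 < omega).
Hypothesis SM : forall (t : R) (x : V), 0 <= t ->
  ip_norm ipV (S t x) <= M * expR (- omega * t) * ip_norm ipV x.
Variables (inr : H -> V) (pr : V -> H).
Hypothesis inrP : forall v x, ipV (inr v) x = ip v (pr x).
Hypothesis pr_norm : forall x, ip_norm ip (pr x) <= ip_norm ipV x.
Variables (Phi Psi : H -> H) (K : R).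
Hypothesis PhiPsi : forall x y, ip (Phi x) y = ip x (Psi y).
Hypothesis K0 : 0 <= K.
Hypothesis PsiK : forall x, ip_norm ip (Psi x) <= K * ip_norm ip x.
Variable e : nat -> H.
Hypothesis one : orthonormal_basis ip e.

Local Notation mu := (@lebesgue_measure R).
Local Notation norm := (ip_norm ip).
Local Notation normV := (ip_norm ipV).
Local Notation proj := (onb_proj ip e).
Local Notation traj := (traj ipV S).

Definition dual_traj x (t : R) : H := pr (adjoint ipV ipV (S t) x).
Local Notation w := dual_traj.

Lemma dual_trajP x v (t : R) : 0 <= t -> traj (inr v) x t = ip v (w x t).
Proof.
move=> t0; case: hS => /(_ t t0) Sb _ _ _.
by rewrite trajE// /w -inrP -(adjointP ipVP ipVP rV Sb).
Qed.

Lemma dual_traj_norm x (t : R) : 0 <= t ->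
  norm (w x t) <= M * expR (- omega * t) * normV x.
Proof.
move=> t0; case: hS => /(_ t t0) Sb _ _ _.
apply: le_trans (pr_norm _) _.
apply: (adjoint_pair_bounded ipVP ipVP _ (adjointP ipVP ipVP rV Sb)).
- by rewrite mulr_ge0// expR_ge0.
- by move=> z; exact: SM.
Qed.

Lemma dual_traj_linear a x y (t : R) : 0 <= t ->
  w (a *: x + y) t = a *: w x t + w y t.
Proof.
move=> t0; apply: (ip_inj ipP) => z.
rewrite -dual_trajP// (ipDr ipP) (ipZr ipP) -!dual_trajP//.
by rewrite /traj (ipDr ipVP) (ipZr ipVP).
Qed.

Let Psi_linear := adjoint_pair_linear ipP ipP PhiPsi.

Let PsiB x y : Psi (x - y) = Psi x - Psi y.
Proof. by rewrite addrC -scaleN1r Psi_linear scaleN1r addrC. Qed.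

Definition gram x y (t : R) : R := ip (Psi (w x t)) (Psi (w y t)).

(** The inner projection moves the test vectors into the domain of the generator; the outer one
    makes the scalar product a finite sum. *)
Definition truncation N v := proj N (Psi (proj N v)).

(* Unlike [gram], which involves the adjoint semigroup, these truncations are
   visibly continuous in [t]; on the finite-dimensional range of [proj N] the
   generator is moreover available. *)
Definition gram_approx N x y (t : R) : R := \sum_(k < N)
  traj (inr (proj N (Phi (e k)))) x t * traj (inr (proj N (Phi (e k)))) y t.

Lemma gram_approxE N x y (t : R) : 0 <= t ->
  gram_approx N x y t = ip (truncation N (w x t)) (truncation N (w y t)).
Proof.
move=> t0; rewrite /truncation -(onb_proj_sym ipP) (onb_proj_idem ipP one).
rewrite (onb_proj_ip ipP); apply: eq_bigr => k _.
by rewrite !dual_trajP// !(onb_proj_sym ipP) !PhiPsi !(ipC ipP (e k)).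
Qed.

Lemma truncation_norm N v : norm (truncation N v) <= K * norm v.
Proof.
rewrite (le_trans (onb_proj_norm ipP one N _))// (le_trans (PsiK _))//.
by rewrite ler_wpM2l// (onb_proj_norm ipP one).
Qed.

Lemma projB N x y : proj N (x - y) = proj N x - proj N y.
Proof. by rewrite addrC -scaleN1r (onb_proj_linear ipP) scaleN1r addrC. Qed.

Lemma truncation_cvg v : ip_cvg ip (truncation ^~ v) (Psi v).
Proof.
have h : K * norm (proj N v - v) + norm (proj N (Psi v) - Psi v) @[N --> \oo] --> (0 : R).
  rewrite -[0]addr0 -{1}(mulr0 K); apply: cvgD; last exact: (onb_proj_cvg one).
  by apply: cvgMl_tmp; exact: (onb_proj_cvg one).
apply: (squeeze_cvgr _ (cvg_cst 0) h); apply: nearW => N.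
rewrite ip_norm_ge0/= /truncation.
rewrite (_ : _ - _ = proj N (Psi (proj N v) - Psi v) + (proj N (Psi v) - Psi v)).
  rewrite (le_trans (ip_normD ipP _ _))// lerD2r.
  by rewrite (le_trans (onb_proj_norm ipP one N _))// -PsiB PsiK.
by rewrite projB addrA subrK.
Qed.

Lemma ip_cvg2 (u v : nat -> H) a b : ip_cvg ip u a -> ip_cvg ip v b ->
  ip (u n) (v n) @[n --> \oo] --> ip a b.
Proof.
move=> ua vb.
have h1 : ip (u n - a) (v n) @[n --> \oo] --> (0 : R).
  have h : norm (u n - a) * norm (v n) @[n --> \oo] --> (0 : R).
    by rewrite -(mul0r (norm b)); apply: cvgM => //; exact: (ip_cvg_norm ipP vb).
  apply/norm_cvg0P; apply: (squeeze_cvgr _ (cvg_cst 0) h); apply: nearW => n.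
  by rewrite normr_ge0/= (cauchy_schwarz ipP).
have h2 : ip a (v n) @[n --> \oo] --> ip a b.
  under eq_fun do rewrite (ipC ipP a).
  by rewrite (ipC ipP a); exact: (@ip_cvgP _ _ _ ipP _ _ vb).
rewrite -[ip a b]add0r (_ : (fun n => ip (u n) (v n)) =
  (fun n => ip (u n - a) (v n) + ip a (v n))); first exact: cvgD.
by apply/funext => n; rewrite (ipBl ipP) subrK.
Qed.

Lemma gram_approx_cvg x y (t : R) : 0 <= t ->
  gram_approx N x y t @[N --> \oo] --> gram x y t.
Proof.
move=> t0; under eq_fun do rewrite gram_approxE//.
by apply: ip_cvg2; exact: truncation_cvg.
Qed.

Definition gram_const x y := K ^+ 2 * M ^+ 2 * normV x * normV y.

Let norm_bound u v x y (t : R) : 0 <= t -> norm u <= K * norm (w x t) ->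
  norm v <= K * norm (w y t) ->
  `|ip u v| <= gram_const x y * expR (- (2 * omega) * t).
Proof.
move=> t0 hu hv; rewrite (le_trans (cauchy_schwarz ipP _ _))//.
have hw z : K * norm (w z t) <= K * (M * expR (- omega * t) * normV z).
  by rewrite ler_wpM2l// dual_traj_norm.
rewrite (le_trans (ler_pM _ _ (le_trans hu (hw _)) (le_trans hv (hw _)))) ?ip_norm_ge0//.
rewrite (_ : - (2 * omega) * t = - omega * t + - omega * t); last by ring.
by rewrite expRD /gram_const le_eqVlt; apply/orP; left; apply/eqP; ring.
Qed.

Lemma gram_bound x y (t : R) : 0 <= t ->
  `|gram x y t| <= gram_const x y * expR (- (2 * omega) * t).
Proof. by move=> t0; apply: norm_bound. Qed.

Lemma gram_approx_bound N x y (t : R) : 0 <= t ->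
  `|gram_approx N x y t| <= gram_const x y * expR (- (2 * omega) * t).
Proof.
by move=> t0; rewrite gram_approxE//; apply: norm_bound => //; exact: truncation_norm.
Qed.

Lemma gram_approx_continuous N x y : continuous (gram_approx N x y).
Proof.
move=> t; apply: cvg_sum_ord => k.
by apply: cvgM; exact: (traj_continuous ipVP hS M0 omega0 SM).
Qed.

Let itv_ge0 (t : R) : `[0, +oo[%classic t -> 0 <= t.
Proof. by rewrite /= in_itv/= andbT. Qed.

Lemma gram_measurable x y : measurable_fun (`[0, +oo[ : set R) (gram x y).
Proof.
apply: (@measurable_fun_cvg _ _ _ _ (fun N => gram_approx N x y)) => [N|t t0].
  apply: measurable_funTS; apply: continuous_measurable_fun.
  exact: gram_approx_continuous.
by apply: gram_approx_cvg; exact: itv_ge0.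
Qed.

Lemma gram_integrable x y : mu.-integrable `[0, +oo[ (fun t => (gram x y t)%:E).
Proof.
have o2 : 0 < 2 * omega by rewrite mulr_gt0.
apply: (le_integrable _ _ _ (expR_integrable (gram_const x y) o2)) => //.
- by apply/measurable_EFinP; exact: gram_measurable.
- move=> t /itv_ge0 t0; rewrite /= lee_fin (le_trans (gram_bound _ _ t0))//.
  exact: ler_norm.
Qed.

Definition gramian x y : R := Rintegral mu `[0, +oo[ (gram x y).

Lemma gramianC x y : gramian x y = gramian y x.
Proof. by apply: eq_Rintegral => t _; rewrite /gram (ipC ipP). Qed.

Lemma gramian_linear a x y z :
  gramian (a *: x + y) z = a * gramian x z + gramian y z.
Proof.
have ia : mu.-integrable `[0, +oo[ (EFin \o (fun t => a * gram x z t)).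
  rewrite (_ : _ \o _ = fun t => (a%:E * (gram x z t)%:E)%E)//.
  by apply: integrableZl => //; exact: gram_integrable.
rewrite /gramian -RintegralZl//; last exact: gram_integrable.
rewrite -RintegralD//; last exact: gram_integrable.
apply: eq_Rintegral => t /set_mem/itv_ge0 t0.
by rewrite /gram dual_traj_linear// Psi_linear (ipDl ipP) (ipZl ipP).
Qed.

Lemma gramian_bounded : exists2 C, 0 <= C &
  forall x y, `|gramian x y| <= C * normV x * normV y.
Proof.
have o2 : 0 < 2 * omega by rewrite mulr_gt0.
pose I := Rintegral mu `[0, +oo[ (fun t => expR (- (2 * omega) * t)).
have iexp : mu.-integrable `[0, +oo[ (EFin \o (fun t => expR (- (2 * omega) * t))).
  have := expR_integrable 1 o2; congr (mu.-integrable _ _).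
  by apply/funext => t; rewrite mul1r.
exists (K ^+ 2 * M ^+ 2 * I).
  rewrite !mulr_ge0 ?sqr_ge0//; apply: Rintegral_ge0 => t _; exact: expR_ge0.
move=> x y; rewrite (le_trans (le_normr_Rintegral _ (gram_integrable x y)))//.
rewrite (_ : K ^+ 2 * M ^+ 2 * I * normV x * normV y = gram_const x y * I); last first.
  by rewrite /gram_const; ring.
rewrite /I -RintegralZl//; apply: le_Rintegral => //.
- by have := integrable_norm (gram_integrable x y).
- exact: expR_integrable.
- by move=> t /itv_ge0 t0; exact: gram_bound.
Qed.

(** The trajectory is the continuous minorant: it equals [<v, Psi (w x t)>], so Cauchy-Schwarz
    bounds its square by [|v|^2] times the integrand. *)
Lemma gramian_gt0 x v (t : R) : 0 <= t -> traj (inr (Phi v)) x t != 0 -> 0 < gramian x x.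
Proof.
move=> t0 xv.
apply: (Rintegral_gt0 (C := norm v ^+ 2) t0 _ _ _ _ xv).
- exact: gram_integrable.
- exact: (traj_continuous ipVP hS M0 omega0 SM).
- move=> s s0; rewrite dual_trajP// PhiPsi /gram -(ip_norm_sqr ipP) -exprMn.
  rewrite -[leLHS]real_normK ?num_real// ler_pXn2r ?nnegrE ?mulr_ge0 ?ip_norm_ge0//.
  exact: (cauchy_schwarz ipP).
- by move=> s _; exact: (ip_ge0 ipP).
Qed.

Section orthogonality.
Variables p r : V.
Hypothesis inr_p : forall v, ipV (inr v) p = 0.
Hypothesis pr_gen : forall N v, exists2 z',
  normV (h^-1 *: (S h (inr (proj N v)) - inr (proj N v)) - z') @[h --> 0^'+] --> (0 : R) &
  forall t : R, 0 <= t -> ipV (S t z') p = ipV (S t (inr (proj N v))) r.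

(** Each summand is the square of a trajectory against [p], and [pr_gen] says that differentiating
    such a trajectory replaces [p] by [r]. *)
Lemma gram_approx_derive N (t : R) : 0 < t ->
  is_derive t 1 (gram_approx N p p) (2 * gram_approx N p r t).
Proof.
move=> t0.
have dk (k : 'I_N) : is_derive t 1 (traj (inr (proj N (Phi (e k)))) p)
    (traj (inr (proj N (Phi (e k)))) r t).
  have [z' zz' z'p] := pr_gen N (Phi (e k)).
  have := traj_is_derive ipVP hS M0 omega0 SM p t0 zz'.
  by rewrite !trajE ?(ltW t0)// z'p// ltW.
rewrite (_ : gram_approx N p p = \sum_(k < N) (traj (inr (proj N (Phi (e k)))) p *
    traj (inr (proj N (Phi (e k)))) p)); last first.
  by apply/funext => s; rewrite fct_sumE.
apply: is_derive_eq.
rewrite /gram_approx mulr_sumr; apply: eq_bigr => k _.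
rewrite /GRing.scale/=; ring.
Qed.

Lemma gram_approx_integral N (b : R) : 0 < b ->
  (\int[mu]_(t in `[0%R, b]) (gram_approx N p r t)%:E = (2^-1 * gram_approx N p p b)%:E)%E.
Proof.
move=> b0.
have dG (t : R) : 0 < t ->
    is_derive t 1 (fun t : R => 2^-1 * gram_approx N p p t) (gram_approx N p r t).
  move=> t0; have := gram_approx_derive N t0 => d.
  by apply: is_derive_eq; rewrite /GRing.scale/= mulrA mulVf// mul1r.
have cG : continuous (fun t => 2^-1 * gram_approx N p p t).
  by move=> t; apply: cvgMl_tmp; exact: gram_approx_continuous.
rewrite (@continuous_FTC2 _ _ (fun t => 2^-1 * gram_approx N p p t)) => //.
(* At time 0 every factor is a product [ipV (inr v) p], zero by [inr_p]; only the boundary term at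
   [b] remains. *)
- rewrite -EFinB; congr EFin; rewrite [X in _ - _ * X]big1 ?mulr0 ?subr0// => k _.
  by case: hS => _ S0 _ _; rewrite !trajE// S0 inr_p mul0r.
- apply: continuous_subspaceT; exact: gram_approx_continuous.
- split.
  + by move=> t; rewrite in_itv/= => /andP[t0 _]; have := dG t t0 => d; exact: ex_derive.
  + by apply/cvg_at_right_filter; exact: cG.
  + by apply/cvg_at_left_filter; exact: cG.
- move=> t; rewrite in_itv/= => /andP[t0 _]; have := dG t t0 => d.
  by rewrite derive1E derive_val.
Qed.

(* [<S(t) z, p>] has derivative [<S(t) z, r>], so the integrand of [gramian p r]
   is half the derivative of a function vanishing at [0] and at infinity. *)
Lemma gramian_orthogonal : gramian p r = 0.
Proof.
have o2 : 0 < 2 * omega by rewrite mulr_gt0.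
(* Truncation level and time horizon grow together, so one dominated convergence handles both
   limits. The successor keeps the interval nondegenerate at [N = 0]. *)
pose f_ N := EFin \o (gram_approx N p r \_ `[0, N.+1%:R]).
have m_ N : measurable_fun (`[0%R, +oo[ : set R) (f_ N).
  apply/measurable_EFinP; apply: measurable_funTS.
  apply/measurable_restrict => //; apply: measurable_funTS.
  by apply: continuous_measurable_fun; exact: gram_approx_continuous.
have f_E N (t : R) : 0 <= t -> t <= N.+1%:R -> f_ N t = (gram_approx N p r t)%:E.
  by move=> t0 tN; rewrite /f_/= patchE mem_set//= in_itv/= t0.
have cvg_f (t : R) : `[0, +oo[%classic t -> f_ ^~ t @ \oo --> (gram p r t)%:E.
  move=> /itv_ge0 t0.
  have : (gram_approx N p r t)%:E @[N --> \oo] --> (gram p r t)%:E.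
    by apply: cvg_EFin; [exact: nearW|exact: gram_approx_cvg].
  apply: cvg_trans; apply: near_eq_cvg; near=> N.
  rewrite f_E// (@le_trans _ _ N%:R) ?ler_nat//.
  by near: N; exact: nbhs_infty_ger.
have bnd_f (t : R) N : `[0, +oo[%classic t -> (`|f_ N t| <=
   (gram_const p r * expR (- (2 * omega) * t))%:E)%E.
  move=> /itv_ge0 t0; have h := gram_approx_bound N p r t0.
  rewrite /f_/= patchE; case: ifP => _; rewrite lee_fin//.
  by rewrite normr0 (le_trans _ h).
have h : (\int[mu]_(t in `[0%R, +oo[) f_ N t)%E @[N --> \oo] -->
    (\int[mu]_(t in `[0%R, +oo[) (gram p r t)%:E)%E.
  case: (@dominated_convergence _ _ _ mu `[0, +oo[ _ f_
    (fun t => (gram p r t)%:E)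
    (fun t => (gram_const p r * expR (- (2 * omega) * t))%:E)) => //.
  - by apply/measurable_EFinP; exact: gram_measurable.
  - by apply: aeW => t; exact: cvg_f.
  - exact: expR_integrable.
  - by apply: aeW => t N; exact: bnd_f.
have intE N : (\int[mu]_(t in `[0%R, +oo[) f_ N t)%E =
    (2^-1 * gram_approx N p p N.+1%:R)%:E.
  rewrite -gram_approx_integral ?ltr0n// /f_ -restrict_EFin -integral_mkcondr.
  congr (integral _ _ _); apply/seteqP; split => t /=; rewrite !in_itv/= andbT.
    by case.
  by move=> /andP[t0 tN]; rewrite t0 tN.
(* The exponential bound is uniform in the truncation level; [exp x >= 1 + x] turns it into a
   multiple of [1 / (N + 1)]. *)
have to0 : 2^-1 * gram_approx N p p N.+1%:R @[N --> \oo] --> (0 : R).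
  have hh : gram_const p p * (2 * omega)^-1 * harmonic N @[N --> \oo] --> (0 : R).
    rewrite -(mulr0 (gram_const p p * (2 * omega)^-1)).
    by apply: cvgMl_tmp; exact: cvg_harmonic.
  apply/norm_cvg0P; apply: (squeeze_cvgr _ (cvg_cst 0) hh); apply: nearW => N.
  have N0 : 0 < N.+1%:R :> R by rewrite ltr0n.
  have C0 : 0 <= gram_const p p by rewrite /gram_const !mulr_ge0 ?sqr_ge0 ?ip_norm_ge0.
  rewrite normr_ge0/= normrM (@ger0_norm _ 2^-1)//.
  apply: (@le_trans _ _ `|gram_approx N p p N.+1%:R|).
    by rewrite ler_piMl//; lra.
  rewrite (le_trans (gram_approx_bound _ _ _ (ltW N0)))// -mulrA ler_wpM2l//.
  rewrite /harmonic/= -invfM mulNr expRN lef_pV2 ?posrE ?expR_gt0 ?mulr_gt0//.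
  by rewrite (le_trans _ (expR_ge1Dx _))// lerDr.
rewrite /gramian /Rintegral.
have -> : (\int[mu]_(t in `[0%R, +oo[) (gram p r t)%:E)%E = 0%:E.
  apply: cvg_unique h _ => //.
  have h0 : (2^-1 * gram_approx N p p N.+1%:R)%:E @[N --> \oo] --> 0%:E.
    by apply: cvg_EFin; [exact: nearW|exact: to0].
  apply: cvg_trans h0; apply: near_eq_cvg; apply: nearW => N.
  by apply/esym; exact: intE.
by [].
Unshelve. all: by end_near. Qed.

End orthogonality.
End gramian.

Lemma nneg_series_gt0 {R : realType} (c : nat -> R) l n : (forall k, 0 <= c k) ->
  series c @ \oo --> l -> 0 < c n -> 0 < l.
Proof.
move=> c0 cl cn; apply: (lt_le_trans cn); apply: le_trans (nneg_series_le n.+1 c0 cl).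
by rewrite big_ord_recr/= lerDr sumr_ge0.
Qed.

(** * The damped wave equation: traces as Gramian sums, and their comparison *)

Section comparison.
Context (R : realType) (H : lmodType R) (ip : {dot H for idfun}).
Variables (e : nat -> H) (alpha : nat -> R) (Phi1 : {linear H -> H}) (a b : R).
Local Notation V := (energy_space ip e alpha).
Local Notation ipV := (@energy_ip R H ip e alpha).
Variable S : R -> {linear V -> V}.
Hypothesis he : orthonormal_basis ip e.
Hypothesis cH : ip_complete ip.
Hypothesis alpha_gt0 : forall n, 0 < alpha n.
Hypothesis alpha_infty : alpha n @[n --> \oo] --> +oo.
Hypothesis hQ : positive_eigenvalues (noise_cov ip Phi1).
Hypothesis ha : 0 < a.
Hypothesis hb : 0 < b.
Hypothesis hS : C0_semigroup ipV S.
Hypothesis hS_gen :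
  generated_by ipV S (wave_dom ip e alpha) (wave_op ip e alpha a b).
Variables (M omega : R).
Hypotheses (M0 : 0 <= M) (omega0 : 0 < omega).
Hypothesis SM : forall (t : R) (x : V), 0 <= t ->
  ip_norm ipV (S t x) <= M * expR (- omega * t) * ip_norm ipV x.
Variable K : R.
Hypothesis K0 : 0 <= K.
Hypothesis Phi1K : forall x, ip_norm ip (Phi1 x) <= K * ip_norm ip x.
Variable f : nat -> H.
Hypothesis onf : orthonormal_basis ip f.
Hypothesis hs_f : cvgn (series (fun n => ip_norm ip (Phi1 (f n)) ^+ 2)).

Let ipP : inner_product ip := dot_inner_product ip.
Let ipVP : inner_product ipV := energy_inner_product he cH alpha_gt0.
Let rV : riesz ipV := energy_riesz he cH alpha_gt0 alpha_infty.
Let Psi := adjoint ip ip Phi1.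

Let PhiPsi x y : ip (Phi1 x) y = ip x (Psi y).
Proof. by apply: adjointP => //; [exact: onb_riesz he cH|exists K]. Qed.

Let PsiK x : ip_norm ip (Psi x) <= K * ip_norm ip x.
Proof. exact: (adjoint_pair_bounded ipP ipP K0 PhiPsi Phi1K). Qed.

Let inr (v : H) : V := (0, v).
Let pr (x : V) : H := x.2.

Let inrP v x : ipV (inr v) x = ip v (pr x).
Proof. exact: energy_ip_inr. Qed.

Let pr_norm x : ip_norm ip (pr x) <= ip_norm ipV x.
Proof. exact: energy_norm_snd. Qed.

Local Notation q := (gramian ip ipV S pr Psi).
Local Notation traj := (traj ipV S).

Lemma noise_adjoint_eq (z : V) :
  adjoint ipV ipV (@noise_op R H ip e alpha Phi1) z = inr (Psi z.2).
Proof.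
apply: (adjoint_eq ipVP) => x.
by rewrite (ipC ipVP x) inrP -[noise_op _ _]/(inr (Phi1 x.2)) inrP PhiPsi (ipC ipP).
Qed.

Let q_linear k x y z : q (k *: x + y) z = k * q x z + q y z.
Proof.
exact: (gramian_linear ipP ipVP rV hS M0 omega0 SM inrP pr_norm PhiPsi K0 PsiK he).
Qed.

Let qC x y : q x y = q y x.
Proof. exact: gramianC. Qed.

Let q_bounded : exists2 C, 0 <= C &
  forall x y, `|q x y| <= C * ip_norm ipV x * ip_norm ipV y.
Proof.
exact: (gramian_bounded ipP ipVP rV hS M0 omega0 SM inrP pr_norm PhiPsi K0 PsiK he).
Qed.

Let q_ge0 x : 0 <= q x x.
Proof. by apply: Rintegral_ge0 => t _; exact: (ip_ge0 ipP). Qed.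

(** The weak integral exists because [q x] is a bounded functional, so Riesz supplies the vector
    that [xget] looks for. *)
Lemma Q_infty_gramian x y : ipV (Q_infty ip e alpha Phi1 S x) y = q x y.
Proof.
pose G t := S t \o @noise_op R H ip e alpha Phi1
  \o adjoint ipV ipV (@noise_op R H ip e alpha Phi1) \o adjoint ipV ipV (S t).
have itv_ge0 (t : R) : `[0, +oo[%classic t -> 0 <= t by rewrite /= in_itv/= andbT.
have GE y' (t : R) : 0 <= t -> ipV (G t x) y' = gram ip ipV S pr Psi x y' t.
  move=> t0; rewrite /G/= noise_adjoint_eq -[noise_op _ _]/(inr (Phi1 (Psi _))).
  by rewrite -(trajE ipV S _ _ t0) (dual_trajP ipVP rV hS inrP)//.
have intE y' : Rintegral lebesgue_measure `[0, +oo[ (fun t => ipV (G t x) y') = q x y'.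
  by apply: eq_Rintegral => t /set_mem/itv_ge0 t0; exact: GE.
pose P := [set z | forall y',
  lebesgue_measure.-integrable `[0, +oo[ (fun t => (ipV (G t x) y')%:E) /\
  ipV z y' = Rintegral lebesgue_measure `[0, +oo[ (fun t => ipV (G t x) y')].
have [z Pz] : exists z, P z.
  have [C C0 hC] := q_bounded.
  have [k u v||z hz] := @rV (fun y' => q x y').
  - by rewrite !(qC x) q_linear.
  - by exists (C * ip_norm ipV x) => y'.
  exists z => y'; split; last by rewrite intE (ipC ipVP) -hz.
  have := gram_integrable ipP ipVP rV hS M0 omega0 SM inrP pr_norm PhiPsi K0 PsiK he x y'.
  by apply: eq_integrable => // t /set_mem/itv_ge0 t0; rewrite GE.
have [_] := xgetPex 0 (ex_intro P z Pz) y.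
by rewrite intE.
Qed.

(** The operator [C], which is [T] after [Q_infty] after the adjoint of [T], is symmetric and
    bounded since [<C u, v> = q (T' u) (T' v)]; [trace_hs_comp] then evaluates the trace along
    [f]. *)
Lemma cov_trace_cvg (T : V -> H) (T' : H -> V) L : 0 <= L ->
  (forall x u, ip (T x) u = ipV x (T' u)) ->
  (forall x, ip_norm ip (T x) <= L * ip_norm ipV x) ->
  series (fun n => q (T' (Phi1 (f n))) (T' (Phi1 (f n)))) @ \oo -->
    cov_trace ip e alpha Phi1 S T.
Proof.
move=> L0 TT' TL.
pose C := T \o Q_infty ip e alpha Phi1 S \o adjoint ipV ip T.
have CE u v : ip (C u) v = q (T' u) (T' v).
  have adjT : adjoint ipV ip T u = T' u by apply: (adjoint_eq ipVP) => x.
  by rewrite /C/= TT' adjT Q_infty_gramian.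
have [Cq Cq0 hq] := q_bounded.
have T'L := adjoint_pair_bounded ipVP ipP L0 TT' TL.
have Cbound u : ip_norm ip (C u) <= Cq * L ^+ 2 * ip_norm ip u.
  have [->|Cu] := eqVneq (ip_norm ip (C u)) 0.
    by rewrite !mulr_ge0 ?sqr_ge0 ?ip_norm_ge0.
  rewrite -(@ler_pM2r _ (ip_norm ip (C u))) ?lt_neqAle 1?eq_sym ?Cu ?ip_norm_ge0//.
  rewrite -expr2 (ip_norm_sqr ipP) CE (le_trans (ler_norm _))//.
  rewrite (le_trans (hq _ _))// -!mulrA ler_wpM2l//.
  rewrite (le_trans (ler_pM _ _ (T'L u) (T'L (C u)))) ?ip_norm_ge0//.
  by rewrite le_eqVlt; apply/orP; left; apply/eqP; ring.
have Csym u v : ip (C u) v = ip u (C v) by rewrite CE qC -CE (ipC ipP).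
have := trace_hs_comp ipP PhiPsi Csym Cbound onf hs_f.
by under eq_fun do rewrite CE.
Qed.

Lemma noise_trace_cvg : series (fun n => ip (Phi1 (f n)) (Phi1 (f n))) @ \oo -->
  trace ip (noise_cov ip Phi1).
Proof.
apply: (trace_hs_comp (C := id) (K := 1) ipP PhiPsi _ _ onf hs_f) => // x.
by rewrite mul1r.
Qed.

(** A nonzero vector killed by [Psi] would be an eigenvector of [noise_cov] for the eigenvalue 0,
    against [hQ]. *)
Let noise_injective w : Psi w = 0 -> w = 0.
Proof.
move=> Pw; apply/eqP; apply: contraT => w0.
have := hQ w0 (lambda := 0); rewrite scale0r /noise_cov /= -/Psi Pw linear0.
by move=> /(_ erefl); rewrite ltxx.
Qed.

(** Otherwise [Psi (e 0)] would be orthogonal to all [f n], hence zero. This index provides a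
    strictly positive term in each of the trace series. *)
Lemma noise_neq0 : exists n, Phi1 (f n) != 0.
Proof.
apply: contrapT => /forallNP h.
have /eqP := onb_neq0 ipP he 0; apply; apply: noise_injective.
apply: (onb_eq ipP onf) => n; rewrite (ip0l ipP) (ipC ipP) -PhiPsi.
by have /negP := h n; rewrite negbK => /eqP ->; rewrite (ip0l ipP).
Qed.

Section position.
Variable p : H -> V.
Hypothesis pP : forall x u, ip (diag_val x.1) u = ipV x (p u).

(** The vector [z'] is the generator applied to [z]. The semigroup preserves the domain and commutes
    with the generator, and pairing with [p u] reads the first component, which [wave_op] fills with
    the velocity. *)
Let pr_gen u N v : exists2 z',
  ip_norm ipV (h^-1 *: (S h (inr (onb_proj ip e N v)) - inr (onb_proj ip e N v)) - z')
    @[h --> 0^'+] --> (0 : R) &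
  forall t, 0 <= t -> ipV (S t z') (p u) = ipV (S t (inr (onb_proj ip e N v))) (inr u).
Proof.
set z := inr _; have dz : wave_dom ip e alpha z by exact: wave_dom_inr.
have gz := (hS_gen z (wave_op ip e alpha a b z)).1 (conj dz erefl).
exists (wave_op ip e alpha a b z) => // t t0.
have [_ _ Sadd _] := hS.
have [dSz wSz] : wave_dom ip e alpha (S t z) /\
    wave_op ip e alpha a b (S t z) = S t (wave_op ip e alpha a b z).
  apply/hS_gen.
  have h0 : M * ip_norm ipV (h^-1 *: (S h z - z) - wave_op ip e alpha a b z)
      @[h --> 0^'+] --> M * 0 by apply: cvgMl_tmp.
  rewrite mulr0 in h0.
  apply: (squeeze_cvgr _ (cvg_cst 0) h0); near=> h.
  have hpos : 0 < h by near: h; exact: nbhs_right_gt.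
  have comm : S h (S t z) = S t (S h z) by rewrite -!Sadd ?(ltW hpos)// addrC.
  rewrite ip_norm_ge0/= comm.
  by rewrite -linearB -linearZ -linearB (semigroup_bounded M0 omega0 SM).
rewrite -wSz -pP wave_op_fst// (ipC ipVP) inrP (ipC ipP).
by [].
Unshelve. all: by end_near. Qed.

Lemma gramian_fst_snd u : q (p u) (inr u) = 0.
Proof.
apply: (gramian_orthogonal ipP ipVP rV hS M0 omega0 SM inrP pr_norm PhiPsi K0 PsiK he).
- by move=> v; rewrite -pP/= (ip0l ipP).
- exact: pr_gen.
Qed.

(* If [q (p u) (p u) = 0] then, [Phi1*] being injective, [<S(t) z, p u> = 0] for
   all [z = (0, v)]; its derivative at [0] is [<v, u>]. *)
Lemma gramian_fst_gt0 u : u != 0 -> 0 < q (p u) (p u).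
Proof.
move=> u0; apply: contrapT => qpu.
have tr0 v t : 0 <= t -> traj (inr (Phi1 v)) (p u) t = 0.
  move=> t0; apply/eqP/negPn/negP => h; apply: qpu.
  exact: (gramian_gt0 ipP ipVP rV hS M0 omega0 SM inrP pr_norm PhiPsi K0 PsiK he t0 h).
have dual0 t : 0 <= t -> dual_traj ipV S pr (p u) t = 0.
  move=> t0; apply: noise_injective; apply: (ip_inj ipP) => v.
  by rewrite -PhiPsi -(dual_trajP ipVP rV hS inrP)// tr0// (ip0r ipP).
have trv v t : 0 <= t -> ipV (S t (inr v)) (p u) = 0.
  move=> t0; rewrite -(trajE ipV S _ _ t0) (dual_trajP ipVP rV hS inrP)//.
  by rewrite dual0// (ip0r ipP).
(* The choice [v = u] may leave the domain of the generator, so the derivative is taken at the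
   projections of [u], which converge to [u]. *)
have proj0 N : ip (onb_proj ip e N u) u = 0.
  have [z' zz' z'p] := pr_gen u N u; have [_ S0 _ _] := hS.
  (* The difference quotients are orthogonal to [p u] and converge to [z']. *)
  have z'0 : ipV z' (p u) = 0.
    apply/normr0_eq0/le_anti; rewrite normr_ge0 andbT.
    have hh : ip_norm ipV (h^-1 *: (S h (inr (onb_proj ip e N u)) -
        inr (onb_proj ip e N u)) - z') * ip_norm ipV (p u) @[h --> 0^'+] -->
        0 * ip_norm ipV (p u) by apply: cvgMr_tmp.
    rewrite mul0r in hh.
    rewrite -(cvg_lim _ hh)//; apply: limr_ge; first exact: cvgP hh.
    near=> h; have hpos : 0 < h by near: h; exact: nbhs_right_gt.
    apply: le_trans (cauchy_schwarz ipVP _ _).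
    rewrite (ipBl ipVP) (ipZl ipVP) (ipBl ipVP) trv ?(ltW hpos)//.
    have := trv (onb_proj ip e N u) 0 (lexx 0); rewrite S0 => ->.
    by rewrite subrr mulr0 sub0r normrN.
  have := z'p 0 (lexx 0); rewrite !S0 z'0 => /esym.
  by rewrite inrP.
have := @ip_cvgP _ _ _ ipP _ _ (onb_proj_cvg he u) u.
rewrite (_ : (fun N => _) = fun=> 0); last by apply/funext => N; exact: proj0.
move/cvg_lim => /(_ (@Rhausdorff R)); rewrite lim_cst// => /esym/(ip_eq0 ipP)/eqP.
by rewrite (negbTE u0).
Unshelve. all: by end_near. Qed.

(** Time 0 suffices: the trajectory there equals [|Phi1 v|^2]. *)
Lemma gramian_snd_gt0 v : Phi1 v != 0 -> 0 < q (inr (Phi1 v)) (inr (Phi1 v)).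
Proof.
move=> v0.
apply: (gramian_gt0 ipP ipVP rV hS M0 omega0 SM inrP pr_norm PhiPsi K0 PsiK he
  (lexx 0) (v := v)).
have [_ S0 _ _] := hS.
by rewrite trajE// S0 inrP gt_eqF// (ip_gt0 ipP).
Qed.

End position.

Lemma limiting_variance_lt :
  let TrQ := trace ip (noise_cov ip Phi1) in
  let TrK := cov_trace ip e alpha Phi1 S in
  4 * a ^+ 2 / TrQ ^+ 2 * TrK (R_tilde1 ip e alpha)
    < 4 * a ^+ 2 / TrQ ^+ 2 * TrK (R_tilde ip e alpha a b)
  /\
  4 * b ^+ 2 / TrQ ^+ 2 * TrK (R_tilde2 ip e alpha a)
    < 4 * b ^+ 2 * (b + 1) ^+ 2 / TrQ ^+ 2 * TrK (R_tilde ip e alpha a b).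
Proof.
move=> TrQ TrK.
have [p pP] := fst_adjoint_ex he cH alpha_gt0 alpha_infty.
have [L L0 hL] := diag_val_bounded he cH alpha_gt0 alpha_infty.
have [n Phin] := noise_neq0.
pose c := 2 * a / (b + 1).
have b1 : 0 < b + 1 by rewrite addr_gt0.
have c_ge0 : 0 <= c by rewrite divr_ge0 ?mulr_ge0 ?(ltW ha) ?(ltW b1).
(* [T1] belongs to the bare embedding of positions, with adjoint [p]; [R_tilde] and [R_tilde2] are
   combinations of it and [R_tilde1]. *)
pose T1 := TrK (fun x => diag_val x.1); pose T2 := TrK (R_tilde1 ip e alpha).
have cvg1 : series (fun n => q (p (Phi1 (f n))) (p (Phi1 (f n)))) @ \oo --> T1.
  by apply: (cov_trace_cvg L0).
have cvg2 : series (fun n => q (inr (Phi1 (f n))) (inr (Phi1 (f n)))) @ \oo --> T2.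
  apply: (cov_trace_cvg ler01) => [x u|x]; last by rewrite mul1r pr_norm.
  by rewrite (ipC ipVP) inrP (ipC ipP).
have T1_gt0 : 0 < T1.
  by apply: (nneg_series_gt0 (n := n) _ cvg1) => //; exact: gramian_fst_gt0.
have T2_gt0 : 0 < T2.
  by apply: (nneg_series_gt0 (n := n) _ cvg2) => //; exact: gramian_snd_gt0.
have TrQ_gt0 : 0 < TrQ.
  apply: (nneg_series_gt0 (n := n) _ noise_trace_cvg) => [k|].
    exact: (ip_ge0 ipP).
  exact: (ip_gt0 ipP).
have q0l z : q 0 z = 0.
  by have := q_linear 1 0 0 z; rewrite scaler0 addr0 mul1r; lra.
have qZ k x : q (k *: x) (k *: x) = k ^+ 2 * q x x.
  have h y : q (k *: x) y = k * q x y by have := q_linear k x 0 y; rewrite addr0 q0l addr0.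
  by rewrite h qC h mulrA -expr2.
have TR2 : TrK (R_tilde2 ip e alpha a) = (2 * a) ^+ 2 * T1.
  have a2 : 0 <= 2 * a by rewrite mulr_ge0// ltW.
  have h : series (fun n => q ((2 * a) *: p (Phi1 (f n))) ((2 * a) *: p (Phi1 (f n))))
      @ \oo --> TrK (R_tilde2 ip e alpha a).
    apply: (cov_trace_cvg (T' := fun u => (2 * a) *: p u) (L := 2 * a * L)
      (mulr_ge0 a2 L0)) => [x u|x].
      by rewrite /R_tilde2 (ipZl ipP) (ipZr ipVP) pP.
    by rewrite /R_tilde2 (ip_normZ ipP) ger0_norm// -[leRHS]mulrA ler_wpM2l.
  apply: (cvgn_unique h).
  rewrite (_ : series _ = fun N => (2 * a) ^+ 2 *
    series (fun n => q (p (Phi1 (f n))) (p (Phi1 (f n)))) N); first exact: cvgMl_tmp.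
  by apply/funext => N; rewrite /series/= mulr_sumr; apply: eq_bigr => k _; rewrite qZ.
have TR : TrK (R_tilde ip e alpha a b) = c ^+ 2 * T1 + T2.
  have h : series (fun n => q (c *: p (Phi1 (f n)) + inr (Phi1 (f n)))
      (c *: p (Phi1 (f n)) + inr (Phi1 (f n)))) @ \oo --> TrK (R_tilde ip e alpha a b).
    apply: (cov_trace_cvg (T' := fun u => c *: p u + inr u) (L := c * L + 1)) => [|x u|x].
    - exact: addr_ge0 (mulr_ge0 c_ge0 L0) ler01.
    - rewrite /R_tilde -/c (ipDl ipP) (ipZl ipP) (ipDr ipVP) (ipZr ipVP) pP.
      by rewrite (ipC ipVP x (inr u)) inrP (ipC ipP u).
    - rewrite /R_tilde -/c (le_trans (ip_normD ipP _ _))// (ip_normZ ipP) ger0_norm//.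
      by rewrite mulrDl mul1r -[in leRHS]mulrA lerD ?ler_wpM2l// pr_norm.
  apply: (cvgn_unique h).
  rewrite (_ : series _ = fun N => c ^+ 2 *
    series (fun n => q (p (Phi1 (f n))) (p (Phi1 (f n)))) N +
    series (fun n => q (inr (Phi1 (f n))) (inr (Phi1 (f n)))) N).
    by apply: cvgD => //; exact: cvgMl_tmp.
  apply/funext => N; rewrite /series/= mulr_sumr -big_split; apply: eq_bigr => k _ /=.
  set x := p _; set y := inr _.
  have xy : q x y = 0 by exact: gramian_fst_snd.
  rewrite q_linear (qC x) (qC y) !q_linear (qC y x) xy; ring.
rewrite TR TR2 -/T2; split.
  rewrite ltr_pM2l; last by rewrite divr_gt0// ?mulr_gt0 ?exprn_gt0.
  by rewrite ltrDr mulr_gt0// exprn_gt0// divr_gt0// mulr_gt0.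
rewrite (_ : 4 * b ^+ 2 * (b + 1) ^+ 2 / TrQ ^+ 2 =
  4 * b ^+ 2 / TrQ ^+ 2 * (b + 1) ^+ 2); last by ring.
rewrite -[ltRHS]mulrA ltr_pM2l; last by rewrite divr_gt0// ?mulr_gt0 ?exprn_gt0.
have cb : (b + 1) * c = 2 * a by rewrite /c mulrC divfK// gt_eqF.
by rewrite mulrDr mulrA -exprMn cb ltrDl mulr_gt0// exprn_gt0.
Qed.

End comparison.

Theorem theorem5p10 (R : realType) (d : nat) (D : smooth_domain R d)
    (e : nat -> L2 (lebesgue_on D)) (alpha : nat -> R)
    (Phi1 : {linear L2 (lebesgue_on D) -> L2 (lebesgue_on D)}) (a b : R)
    (S : R -> {linear energy_space (L2_ip (lebesgue_on D)) e alpha ->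
                      energy_space (L2_ip (lebesgue_on D)) e alpha})
    (he : orthonormal_basis (L2_ip (lebesgue_on D)) e)
    (halpha_gt0 : forall n, 0 < alpha n)
    (halpha_infty : alpha n @[n --> \oo] --> +oo)
    (hPhi1 : hilbert_schmidt (L2_ip (lebesgue_on D)) Phi1)
    (hQ : positive_eigenvalues (noise_cov (L2_ip (lebesgue_on D)) Phi1))
    (ha : 0 < a) (hb : 0 < b)
    (hS : C0_semigroup (energy_ip (L2_ip (lebesgue_on D)) e alpha) S)
    (hS_gen : generated_by (energy_ip (L2_ip (lebesgue_on D)) e alpha) S
       (wave_dom (L2_ip (lebesgue_on D)) e alpha)
       (wave_op (L2_ip (lebesgue_on D)) e alpha a b))
    (hS_stable :
       exponentially_stable (energy_ip (L2_ip (lebesgue_on D)) e alpha) S) :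
  let ip := L2_ip (lebesgue_on D) in
  let TrQ := trace ip (noise_cov ip Phi1) in
  let TrK := cov_trace ip e alpha Phi1 S in
  4 * a ^+ 2 / TrQ ^+ 2 * TrK (R_tilde1 ip e alpha)
    < 4 * a ^+ 2 / TrQ ^+ 2 * TrK (R_tilde ip e alpha a b)
  /\
  4 * b ^+ 2 / TrQ ^+ 2 * TrK (R_tilde2 ip e alpha a)
    < 4 * b ^+ 2 * (b + 1) ^+ 2 / TrQ ^+ 2 * TrK (R_tilde ip e alpha a b).
Proof.
have ipP := L2_inner_product (lebesgue_on D).
have cH := @L2_complete _ _ _ (lebesgue_on D).
have [[K hK] [f onf hs_f]] := hPhi1.
have [M [omega [omega_gt0 hM]]] := hS_stable.
(* The constants given by stability and boundedness may have any sign; the maximum with 0 keeps the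
   bounds valid and nonnegative. *)
apply: (limiting_variance_lt he cH halpha_gt0 halpha_infty hQ ha hb hS hS_gen
  (M := Num.max M 0) (K := Num.max K 0) _ omega_gt0 _ _ _ onf hs_f).
- by rewrite le_max lexx orbT.
- move=> t x t0; rewrite (le_trans (hM t x t0))// ler_wpM2r ?ip_norm_ge0//.
  by rewrite ler_wpM2r ?expR_ge0// le_max lexx.
- by rewrite le_max lexx orbT.
- by move=> x; rewrite (le_trans (hK x))// ler_wpM2r ?ip_norm_ge0// le_max lexx.
Qed.
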